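(* Let $(\mathcal{E},\mathcal{E}')$ be a pair of confocal ellipses (sharing the same foci), with $\mathcal{E}'$ in the interior of $\mathcal{E}$, admitting a Poncelet 3-periodic family, i.e. a one-parameter family of triangles inscribed in $\mathcal{E}$ and circumscribed about $\mathcal{E}'$. For a triangle $P_1P_2P_3$ of this family and $i=1,2,3$, let $P_i'$ be the excenter opposite $P_i$, let $\Delta_i$ be the area of the circumellipse of $P_1P_2P_3$ centered at $P_i'$, let $\Omega_i$ be the area of the excircle of $P_1P_2P_3$ centered at $P_i'$, and let $\rho=r/R$ be the ratio of the inradius $r$ to the circumradius $R$ of $P_1P_2P_3$. Then the quantity $\frac{\Delta_1}{\Omega_1}+\frac{\Delta_2}{\Omega_2}+\frac{\Delta_3}{\Omega_3}$ is invariant over the family (the same for all its triangles), and $$\frac{\Delta_1}{\Omega_1}+\frac{\Delta_2}{\Omega_2}+\frac{\Delta_3}{\Omega_3}=\frac{2}{\rho}.$$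
   Context: A Poncelet 3-periodic family of $(\mathcal{E},\mathcal{E}')$: every point of $\mathcal{E}$ is a vertex of a triangle whose three vertices lie on $\mathcal{E}$ and whose three sides are tangent to $\mathcal{E}'$; the family is the set of all such triangles. A circumellipse of a triangle is an ellipse passing through its three vertices; the circumellipse centered at a given point is the one having that point as its center. *)

(* Defs.v *)
From HB Require Import structures.
From mathcomp Require Import all_boot all_order all_algebra.
From mathcomp Require Import all_classical all_reals all_analysis.
Set Implicit Arguments.
Unset Strict Implicit.
Unset Printing Implicit Defensive.
Import Order.TTheory GRing.Theory Num.Theory.
Local Open Scope classical_set_scope.
Local Open Scope ring_scope.

Notation plane R := (R * R)%type.

(* The norm inherited by R * R is the sup norm, hence an explicit distance. *)
Definition dist (R : realType) (A B : plane R) : R :=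
  Num.sqrt ((A.1 - B.1) ^+ 2 + (A.2 - B.2) ^+ 2).

Definition lerp (R : realType) (A B : plane R) (t : R) : plane R :=
  (A.1 + t * (B.1 - A.1), A.2 + t * (B.2 - A.2)).

Definition midpoint (R : realType) (A B : plane R) : plane R :=
  lerp A B (2^-1).

Definition line (R : realType) (A B : plane R) : set (plane R) :=
  range (lerp A B).

(* S is a circle or an ellipse here: for these, tangency of a line means
   having exactly one common point with the curve. *)
Definition tangent_at (R : realType) (L S : set (plane R)) (T : plane R) :=
  L `&` S = [set T].

(* Planar Lebesgue measure. Only used on bounded regions, so that fine does
   not hide an infinite value. *)
Definition area (R : realType) (S : set (plane R)) : R :=
  fine ((@lebesgue_measure R \x @lebesgue_measure R)%E S).

(* Circles are the ellipses whose foci coincide. *)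
Record ellipse (R : realType) := Ellipse {
  focus1 : plane R; focus2 : plane R; major_axis : R }.

HB.instance Definition _ (R : realType) := gen_eqMixin (ellipse R).
HB.instance Definition _ (R : realType) := gen_choiceMixin (ellipse R).
HB.instance Definition _ (R : realType) :=
  isPointed.Build (ellipse R) (Ellipse 0 0 0).

Section Ellipse.
Variables (R : realType) (E : ellipse R).

Definition is_ellipse : Prop := dist (focus1 E) (focus2 E) < major_axis E.

Definition foci : set (plane R) := [set focus1 E; focus2 E].

Definition ellipse_center : plane R := midpoint (focus1 E) (focus2 E).

Definition ellipse_curve : set (plane R) :=
  [set Q | dist Q (focus1 E) + dist Q (focus2 E) = major_axis E].

Definition ellipse_interior : set (plane R) :=
  [set Q | dist Q (focus1 E) + dist Q (focus2 E) < major_axis E].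

Definition ellipse_region : set (plane R) :=
  [set Q | dist Q (focus1 E) + dist Q (focus2 E) <= major_axis E].

End Ellipse.

Record circle (R : realType) := Circle { center : plane R; radius : R }.

HB.instance Definition _ (R : realType) := gen_eqMixin (circle R).
HB.instance Definition _ (R : realType) := gen_choiceMixin (circle R).
HB.instance Definition _ (R : realType) :=
  isPointed.Build (circle R) (Circle 0 0).

Definition circle_curve (R : realType) (C : circle R) : set (plane R) :=
  [set Q | dist Q (center C) = radius C].

Definition disk (R : realType) (C : circle R) : set (plane R) :=
  [set Q | dist Q (center C) <= radius C].

(* The side opposite the vertex P i joins P (ordS i) and P (ord_pred i), where
   ordS and ord_pred are the cyclic successor and predecessor on 'I_3. *)
Section Triangle.
Variables (R : realType) (P : 'I_3 -> plane R).

Definition side_line (i : 'I_3) : set (plane R) :=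
  line (P (ordS i)) (P (ord_pred i)).

Definition is_triangle : Prop := injective P /\ ~ side_line ord0 (P ord0).

Definition is_circumcircle (C : circle R) : Prop :=
  0 < radius C /\ forall i, circle_curve C (P i).

Definition is_incircle (C : circle R) : Prop :=
  0 < radius C /\ forall i, exists2 t : R, 0 < t < 1 &
    tangent_at (side_line i) (circle_curve C)
      (lerp (P (ordS i)) (P (ord_pred i)) t).

(* C touches the side opposite P i, and touches the extensions of the other
   two sides beyond their endpoints distinct from P i. *)
Definition is_excircle (i : 'I_3) (C : circle R) : Prop :=
  [/\ 0 < radius C,
      exists2 t : R, 0 < t < 1 &
        tangent_at (side_line i) (circle_curve C)
          (lerp (P (ordS i)) (P (ord_pred i)) t) &
      forall j, j != i -> exists2 t : R, 1 < t &
        tangent_at (line (P i) (P j)) (circle_curve C) (lerp (P i) (P j) t)].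

Definition is_circumellipse_at (c : plane R) (E : ellipse R) : Prop :=
  [/\ is_ellipse E, ellipse_center E = c & forall i, ellipse_curve E (P i)].

(* Each of the following objects exists and is unique for a nondegenerate
   triangle, except that the circumellipse is represented twice, with its foci
   in either order. *)
Definition circumcircle : circle R := get [set C | is_circumcircle C].
Definition incircle : circle R := get [set C | is_incircle C].
Definition excircle (i : 'I_3) : circle R := get [set C | is_excircle i C].
Definition excenter (i : 'I_3) : plane R := center (excircle i).

(* The ellipse exists when c is an excenter, but not for every c. *)
Definition circumellipse (c : plane R) : ellipse R :=
  get [set E | is_circumellipse_at c E].

Definition circumradius : R := radius circumcircle.
Definition inradius : R := radius incircle.

Definition circumellipse_area (i : 'I_3) : R :=
  area (ellipse_region (circumellipse (excenter i))).

Definition excircle_area (i : 'I_3) : R := area (disk (excircle i)).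

End Triangle.

Definition confocal (R : realType) (E E' : ellipse R) : Prop :=
  foci E = foci E'.

Definition poncelet_triangle (R : realType) (E E' : ellipse R)
    (P : 'I_3 -> plane R) : Prop :=
  [/\ is_triangle P,
      forall i, ellipse_curve E (P i) &
      forall i, exists T, tangent_at (side_line P i) (ellipse_curve E') T].

Definition admits_poncelet3 (R : realType) (E E' : ellipse R) : Prop :=
  forall Q, ellipse_curve E Q ->
    exists P, poncelet_triangle E E' P /\ exists i, P i = Q.

(* Main.v *)
(* Second identity.  For a triangle with sides a, b, c and twice the area X, let
   D = - a + b + c.  The excenter opposite to the side a is the barycenter with
   weights (- a, b, c), which gives the exradius |X| / D; the circumellipse
   centred there is determined by the Gram matrix of two of its radii, which
   gives the product abc / D of its semi-axes.  Since the area of an ellipse is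
   the product of its semi-axes times a universal constant, the ratio of areas
   is abc D / X^2, and the three ratios add up to abc (a + b + c) / X^2 = 2R/r.

   Invariance.  Map E, with semi-axes A and B, to the unit circle by an affine
   transformation and let u_1, u_2, u_3 be the images of the vertices.  Tangency
   of the chord P_i P_j to the confocal ellipse E', with A^2 - A'^2 = l, means
   both |P_i P_j| = (A B / sqrt l) (1 - u_i . u_j) and that u_i and u_j are
   conjugate for a fixed diagonal conic.  A self-polar triangle inscribed in the
   unit circle has a constant sum of the u_i . u_j, so the perimeter is constant;
   as X^2 = 2 A^2 B^2 prod (1 - u_i . u_j), so is abc (a + b + c) / X^2. *)
Require Import Defs.
From HB Require Import structures.
From mathcomp Require Import all_boot all_order all_algebra.
From mathcomp Require Import all_classical all_reals all_analysis.
From mathcomp Require Import measurable_realfun.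
From mathcomp Require Import ring lra.
Set Implicit Arguments.
Unset Strict Implicit.
Unset Printing Implicit Defensive.
Import Order.TTheory GRing.Theory Num.Theory.
Import numFieldNormedType.Exports.
Local Open Scope classical_set_scope.
Local Open Scope ring_scope.

(** * Areas of elliptic regions *)

(** Area of the unit half-disk: [Num.sqrt] is 0 on negative numbers, so the integral may run over
    the whole line. Finiteness and positivity suffice to cancel it from quotients of areas. *)
Definition semidisk_area (R : realType) : R :=
  fine (\int[@lebesgue_measure R]_x (Num.sqrt (1 - x ^+ 2))%:E)%E.

Lemma continuous_semicircle (R : realType) (h c : R) :
  continuous (fun x : R => Num.sqrt (h - (x - c) ^+ 2)).
Proof.
move=> x.
apply: (@continuous_comp R R R (fun x => h - (x - c) ^+ 2) (@Num.sqrt R));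
  last exact: sqrt_continuous.
apply: cvgB; first exact: cvg_cst.
apply: (@continuous_comp R R R (fun x => x - c) (fun y => y ^+ 2));
  last exact: exprn_continuous.
by apply: cvgB; [exact: cvg_id|exact: cvg_cst].
Qed.

Lemma measurable_unit_semicircle (R : realType) :
  measurable_fun setT (fun x : R => (Num.sqrt (1 - x ^+ 2))%:E).
Proof.
apply/measurable_EFinP; apply: continuous_measurable_fun.
have -> : (fun x : R => Num.sqrt (1 - x ^+ 2))
          = (fun x => Num.sqrt (1 - (x - 0) ^+ 2)).
  by apply/funext => x; rewrite subr0.
exact: continuous_semicircle.
Qed.

Lemma integral_semicircle (R : realType) :
  (\int[@lebesgue_measure R]_x (Num.sqrt (1 - x ^+ 2))%:E)%E
  = (semidisk_area R)%:E.
Proof.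
rewrite /semidisk_area fineK// ge0_fin_numE; last first.
  by apply: integral_ge0 => x _; rewrite lee_fin sqrtr_ge0.
have mI : measurable `[(-1 : R), 1] by [].
apply: (@le_lt_trans _ _ (\int[@lebesgue_measure R]_x (\1_(`[(-1 : R), 1]) x)%:E)%E).
  apply: ge0_le_integral => //.
  - exact: measurable_unit_semicircle.
  - by apply/measurable_EFinP; exact: measurable_indic.
  - move=> x _; rewrite lee_fin indicE.
    have [xI|xI] := boolP (x \in `[(-1 : R), 1]).
      rewrite mem_setE/= xI -[leRHS]sqrtr1 ler_wsqrtr// gerBl sqr_ge0//.
    rewrite mem_setE/= (negbTE xI) ler0_sqrtr// subr_le0.
    move: xI; rewrite in_itv/= => /negP xI.
    by rewrite leNgt; apply/negP => x1; apply: xI; nra.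
have -> : (\int[@lebesgue_measure R]_x (\1_(`[(-1 : R), 1]) x)%:E)%E
          = lebesgue_measure (`[(-1 : R), 1] : set R).
  by rewrite integral_indic// setIT.
by rewrite lebesgue_measure_itv/=; case: ifP => _; rewrite -?EFinB ltry.
Qed.

Lemma semidisk_area_gt0 (R : realType) : 0 < semidisk_area R.
Proof.
rewrite -lte_fin -integral_semicircle.
have mI : measurable `[0 : R, 2^-1] by [].
(* The integrand is at least [1/2] on [[0, 1/2]]. *)
apply: (@lt_le_trans _ _
   (\int[@lebesgue_measure R]_x (2^-1 * \1_(`[0 : R, 2^-1]) x)%:E)%E).
  under eq_integral do rewrite EFinM.
  rewrite ge0_integralZl_EFin//; last first.
    by apply/measurable_EFinP; exact: measurable_indic.
  have -> : (\int[@lebesgue_measure R]_x (\1_(`[(0 : R), 2^-1]) x)%:E)%E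
          = lebesgue_measure (`[(0 : R), 2^-1] : set R).
    by rewrite integral_indic// setIT.
  rewrite lebesgue_measure_itv/= lte_fin invr_gt0 ltr0n.
  by rewrite -EFinB -EFinM lte_fin; lra.
apply: ge0_le_integral => //.
- by apply/measurable_EFinP; apply: measurable_funM => //; exact: measurable_indic.
- exact: measurable_unit_semicircle.
- move=> x _; rewrite lee_fin indicE.
  have [xI|xI] := boolP (x \in `[(0 : R), 2^-1]).
    rewrite mem_setE/= xI mulr1; move: xI; rewrite in_itv/= => /andP[x0 x1].
    have <- : Num.sqrt ((2^-1 : R) ^+ 2) = 2^-1.
      by rewrite sqrtr_sqr ger0_norm.
    by rewrite ler_wsqrtr//; nra.
  by rewrite mem_setE/= (negbTE xI) mulr0 sqrtr_ge0.
Qed.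

(** Cavalieri's principle, then the substitution [h * x + c]: one factor [h] comes from the
    derivative, the other from the square root. *)
Lemma area_of_semicircle_sections (R : realType) (S : set (plane R)) (c h k : R) :
  0 < h -> 0 <= k ->
  (forall x, lebesgue_measure (xsection S x)
             = (k * Num.sqrt (h ^+ 2 - (x - c) ^+ 2))%:E) ->
  area S = k * h ^+ 2 * semidisk_area R.
Proof.
move=> h0 k0 HS; rewrite /area /product_measure1.
under eq_integral do rewrite /= HS.
have dF (x : R) : is_derive x 1 (fun x => h * x + c) h.
  by apply: is_derive_eq; rewrite addr0 /GRing.scale/= mulr1.
have F'E : (fun x => h * x + c)^`()%classic = cst h.
  by apply/funext => x; rewrite derive1E derive_val.
rewrite (@increasing_ge0_integration_by_substitutionT R (fun x => h * x + c)
  (fun x => k * Num.sqrt (h ^+ 2 - (x - c) ^+ 2))); first last.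
- by move=> x; rewrite mulr_ge0// sqrtr_ge0.
- by move=> x; apply: cvgM; [exact: cvg_cst|exact: continuous_semicircle].
- apply/cvgryPge => A; near=> x.
  have : (A - c) / h <= x by near: x; apply: nbhs_pinfty_ge; exact: num_real.
  by rewrite ler_pdivrMr// => ? /=; lra.
- apply/cvgrNyPle => A; near=> x.
  have : x <= (A - c) / h by near: x; apply: nbhs_ninfty_le; exact: num_real.
  by rewrite ler_pdivlMr// => ? /=; lra.
- by [].
- by rewrite F'E; exact: is_cvg_cst.
- by rewrite F'E; exact: is_cvg_cst.
- by rewrite F'E => x; exact: cvg_cst.
- by move=> x y xy; rewrite ltrD2r ltr_pM2l.
rewrite F'E.
transitivity (fine (\int[@lebesgue_measure R]_x
    ((k * h ^+ 2)%:E * (Num.sqrt (1 - x ^+ 2))%:E))%E).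
  congr fine; apply: eq_integral => x _; rewrite -EFinM; congr EFin.
  transitivity (k * Num.sqrt (h ^+ 2 - (h * x + c - c) ^+ 2) * h); first by [].
  rewrite addrK exprMn -{1}[h ^+ 2]mulr1 -mulrBr.
  by rewrite sqrtrM ?sqr_ge0// sqrtr_sqr ger0_norm 1?ltW//; ring.
rewrite ge0_integralZl_EFin//; first by rewrite integral_semicircle.
- exact: measurable_unit_semicircle.
- by rewrite mulr_ge0// sqr_ge0.
Unshelve. all: by end_near. Qed.

(** * Quadratic form and area of an ellipse *)

Lemma dist_ge0 (R : realType) (A B : plane R) : 0 <= dist A B.
Proof. exact: sqrtr_ge0. Qed.

Lemma dist_sqr (R : realType) (A B : plane R) :
  dist A B ^+ 2 = (A.1 - B.1) ^+ 2 + (A.2 - B.2) ^+ 2.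
Proof. by rewrite sqr_sqrtr// addr_ge0// sqr_ge0. Qed.

(** Completing the square in [y] exhibits the vertical sections of an elliptic region as
    intervals. *)
Lemma conic_complete_square (R : realType) (A f g x y : R) :
  A ^+ 2 - g ^+ 2 != 0 ->
  (A ^+ 2 - g ^+ 2) * (A ^+ 2 * (x ^+ 2 + y ^+ 2) - (f * x + g * y) ^+ 2
                       - A ^+ 2 * (A ^+ 2 - (f ^+ 2 + g ^+ 2)))
  = ((A ^+ 2 - g ^+ 2) * (y - f * g * x / (A ^+ 2 - g ^+ 2))) ^+ 2
    - A ^+ 2 * (A ^+ 2 - (f ^+ 2 + g ^+ 2)) * (A ^+ 2 - g ^+ 2 - x ^+ 2).
Proof. by move=> m0; field. Qed.

Section EllipseForm.
Variables (R : realType) (E : ellipse R).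

Definition semi_major : R := major_axis E / 2.

Definition focal_vector : plane R :=
  (((focus1 E).1 - (focus2 E).1) / 2, ((focus1 E).2 - (focus2 E).2) / 2).

Definition semi_minor : R :=
  Num.sqrt (semi_major ^+ 2 - (focal_vector.1 ^+ 2 + focal_vector.2 ^+ 2)).

(** In principal axes this is [B^2 x^2 + A^2 y^2], with [A], [B] the semi-axes, so the curve is the
    level [(A B)^2]. The focal vector avoids any choice of axes and covers circles as well. *)
Definition ellipse_form (v : plane R) : R :=
  semi_major ^+ 2 * (v.1 ^+ 2 + v.2 ^+ 2)
  - (focal_vector.1 * v.1 + focal_vector.2 * v.2) ^+ 2.

Definition from_center (Q : plane R) : plane R :=
  (Q.1 - (ellipse_center E).1, Q.2 - (ellipse_center E).2).

Hypothesis hE : is_ellipse E.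

Lemma semi_major_gt0 : 0 < semi_major.
Proof.
by rewrite /semi_major divr_gt0//; apply: le_lt_trans hE; exact: dist_ge0.
Qed.

Lemma focal_vector_lt :
  focal_vector.1 ^+ 2 + focal_vector.2 ^+ 2 < semi_major ^+ 2.
Proof.
have := dist_sqr (focus1 E) (focus2 E).
have := hE; rewrite /is_ellipse /semi_major /=.
have := dist_ge0 (focus1 E) (focus2 E).
move: (dist _ _) => d d0 dA dE.
have : d ^+ 2 < (major_axis E) ^+ 2 by rewrite ltr_sqr ?nnegrE//; lra.
by rewrite dE; lra.
Qed.

Lemma semi_minor_sqr :
  semi_minor ^+ 2
  = semi_major ^+ 2 - (focal_vector.1 ^+ 2 + focal_vector.2 ^+ 2).
Proof. by rewrite sqr_sqrtr// subr_ge0 ltW// focal_vector_lt. Qed.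

Lemma semi_minor_gt0 : 0 < semi_minor.
Proof. by rewrite sqrtr_gt0 subr_gt0 focal_vector_lt. Qed.

(* With d1, d2 the focal distances, A and B the semi-axes and q the form,
   ((d1 + d2)^2 - 4A^2) ((d1 - d2)^2 - 4A^2) = 16 (A^2 B^2 - q),
   where |d1 - d2| < 2A by the triangle inequality. *)
Lemma focal_sum_form (Q : plane R) : exists2 k : R, 0 < k &
  ellipse_form (from_center Q) - (semi_major * semi_minor) ^+ 2
  = k * (dist Q (focus1 E) + dist Q (focus2 E) - major_axis E).
Proof.
have d1_ge0 := dist_ge0 Q (focus1 E); have d2_ge0 := dist_ge0 Q (focus2 E).
have A0 := semi_major_gt0; have fA := focal_vector_lt.
have d1E : dist Q (focus1 E) ^+ 2
  = ((from_center Q).1 - focal_vector.1) ^+ 2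
    + ((from_center Q).2 - focal_vector.2) ^+ 2.
  by rewrite dist_sqr /= ; field.
have d2E : dist Q (focus2 E) ^+ 2
  = ((from_center Q).1 + focal_vector.1) ^+ 2
    + ((from_center Q).2 + focal_vector.2) ^+ 2.
  by rewrite dist_sqr /= ; field.
rewrite exprMn semi_minor_sqr /ellipse_form.
have -> : major_axis E = 2 * semi_major by rewrite /semi_major mulrC divfK.
move: (dist Q _) (dist Q _) (from_center Q) focal_vector semi_major
  d1_ge0 d2_ge0 A0 fA d1E d2E => d1 d2 [x y] [f g] A /= d1_ge0 d2_ge0 A0 fA d1E d2E.
(* The squares of the two sides differ by [4 * (x * g - y * f) ^+ 2]. The bound then yields
   [(d1 - d2) ^+ 2 <= 4 * (f ^+ 2 + g ^+ 2)]. *)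
have dd : x ^+ 2 + y ^+ 2 - (f ^+ 2 + g ^+ 2) <= d1 * d2.
  apply: le_trans (ler_norm _) _.
  rewrite -ler_sqr ?nnegrE ?mulr_ge0// real_normK ?num_real// exprMn d1E d2E.
  have := sqr_ge0 (x * g - y * f); lra.
have d12 : (d1 - d2) ^+ 2 < 4 * A ^+ 2.
  have -> : (d1 - d2) ^+ 2 = d1 ^+ 2 + d2 ^+ 2 - 2 * (d1 * d2) by ring.
  by rewrite d1E d2E; lra.
exists ((4 * A ^+ 2 - (d1 - d2) ^+ 2) * (d1 + d2 + 2 * A) / 16).
  by rewrite divr_gt0// mulr_gt0 ?subr_gt0//; lra.
apply: (@mulfI _ 16); first by rewrite pnatr_eq0.
transitivity ((4 * A ^+ 2 - (d1 - d2) ^+ 2) * (d1 + d2 + 2 * A) * (d1 + d2 - 2 * A));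
  last by field.
have -> : (4 * A ^+ 2 - (d1 - d2) ^+ 2) * (d1 + d2 + 2 * A) * (d1 + d2 - 2 * A)
  = 8 * A ^+ 2 * (d1 ^+ 2 + d2 ^+ 2) - (d1 ^+ 2 - d2 ^+ 2) ^+ 2 - 16 * A ^+ 4.
  by ring.
by rewrite d1E d2E; ring.
Qed.

Lemma ellipse_curveE (Q : plane R) : ellipse_curve E Q <->
  ellipse_form (from_center Q) = (semi_major * semi_minor) ^+ 2.
Proof.
have [k k0 kE] := focal_sum_form Q; rewrite /ellipse_curve /mkset.
split => [QE|QE].
  by apply/eqP; rewrite -subr_eq0 kE QE subrr mulr0.
move: kE; rewrite QE subrr => /esym/eqP; rewrite mulf_eq0 gt_eqF//=.
by rewrite subr_eq0 => /eqP.
Qed.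

Lemma ellipse_regionE (Q : plane R) : ellipse_region E Q <->
  ellipse_form (from_center Q) <= (semi_major * semi_minor) ^+ 2.
Proof.
have [k k0 kE] := focal_sum_form Q; rewrite /ellipse_region /mkset.
by rewrite -[X in _ <-> is_true X]subr_le0 kE pmulr_rle0// subr_le0.
Qed.

Lemma ellipse_area :
  area (ellipse_region E) = 2 * semi_major * semi_minor * semidisk_area R.
Proof.
have A0 := semi_major_gt0; have B0 := semi_minor_gt0.
have AB0 : 0 < (semi_major * semi_minor) ^+ 2 by exact: exprn_gt0 (mulr_gt0 A0 B0).
have BE := semi_minor_sqr; have fA := focal_vector_lt.
set c := ellipse_center E.
(* The coefficient of [y^2] in the form. The section over [x] is the interval centred at [y0] with
   half-width [A B sqrt D / m], and is empty when [D < 0]. *)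
set m := semi_major ^+ 2 - focal_vector.2 ^+ 2.
have m0 : 0 < m by rewrite /m; have := sqr_ge0 focal_vector.1; lra.
set h := Num.sqrt m.
have h0 : 0 < h by rewrite sqrtr_gt0.
have hm : h ^+ 2 = m by rewrite sqr_sqrtr// ltW.
rewrite (@area_of_semicircle_sections R _ c.1 h (2 * semi_major * semi_minor / m))//.
- by rewrite hm divfK// gt_eqF.
- exact: divr_ge0 (mulr_ge0 (mulr_ge0 (ler0n _ 2) (ltW A0)) (ltW B0)) (ltW m0).
move=> x; rewrite hm.
set D := m - (x - c.1) ^+ 2.
set y0 := c.2 + focal_vector.1 * focal_vector.2 * (x - c.1) / m.
have formE y : m * (ellipse_form (from_center (x, y)) - (semi_major * semi_minor) ^+ 2)
    = (m * (y - y0)) ^+ 2 - (semi_major * semi_minor) ^+ 2 * D.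
  have yE : y - y0 = y - c.2 - focal_vector.1 * focal_vector.2 * (x - c.1) / m.
    by rewrite /y0 opprD addrA.
  rewrite exprMn BE yE; apply: conic_complete_square; exact: lt0r_neq0.
have regE y : ellipse_region E (x, y) <->
    (m * (y - y0)) ^+ 2 <= (semi_major * semi_minor) ^+ 2 * D.
  rewrite ellipse_regionE -[X in is_true X <-> _]subr_le0 -(pmulr_rle0 _ m0).
  by rewrite formE subr_le0.
have [D0|D0] := ltP D 0.
  rewrite ler0_sqrtr 1?ltW// mulr0 (_ : xsection _ _ = set0) ?measure0//.
  rewrite -subset0 => y /xsectionP /regE.
  move=> /(le_trans (sqr_ge0 _)); rewrite (pmulr_rge0 _ AB0).
  by rewrite leNgt D0.
set w := semi_major * semi_minor / m * Num.sqrt D.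
have w0 : 0 <= w.
  exact: mulr_ge0 (divr_ge0 (mulr_ge0 (ltW A0) (ltW B0)) (ltW m0)) (sqrtr_ge0 D).
rewrite (_ : xsection _ _ = `[y0 - w, y0 + w]%classic); last first.
  apply/seteqP; split => y.
    move=> /xsectionP /regE H; rewrite /= in_itv/=.
    suff : `|y - y0| <= w by rewrite ler_norml => /andP[? ?]; apply/andP; split; lra.
    rewrite -ler_sqr ?nnegrE// real_normK ?num_real// /w exprMn sqr_sqrtr// expr_div_n.
    by rewrite mulrAC ler_pdivlMr ?exprn_gt0// mulrC -exprMn.
  rewrite /= in_itv/= => /andP[y1 y2]; apply/xsectionP/regE.
  have : `|y - y0| <= w by rewrite ler_norml; apply/andP; split; lra.
  rewrite -ler_sqr ?nnegrE// real_normK ?num_real// /w exprMn sqr_sqrtr// expr_div_n.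
  by rewrite mulrAC ler_pdivlMr ?exprn_gt0// mulrC -exprMn.
(* The measure of an interval is 0 unless its endpoints are strictly ordered; since [w >= 0], that
   case forces [w = 0]. *)
rewrite lebesgue_measure_itv/= lte_fin; case: ltP => yw.
  by rewrite -EFinB; congr EFin; rewrite /w; field; exact: lt0r_neq0.
congr EFin; have : w = 0 by lra.
rewrite /w => W; transitivity (2 * (semi_major * semi_minor / m * Num.sqrt D)).
  by rewrite W mulr0.
by ring.
Qed.

End EllipseForm.

Lemma disk_area (R : realType) (C : circle R) : 0 < Defs.radius C ->
  area (disk C) = 2 * Defs.radius C ^+ 2 * semidisk_area R.
Proof.
case: C => c r /= r0.
(* A disk is the elliptic region with both foci at its centre and major axis [2 r]. *)
have rE : is_ellipse (Ellipse c c (2 * r)).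
  by rewrite /is_ellipse /dist /= !subrr expr0n/= addr0 sqrtr0 mulr_gt0.
have -> : disk (Circle c r) = ellipse_region (Ellipse c c (2 * r)).
  by apply/funext => Q; apply/propext; rewrite /disk /ellipse_region /=; lra.
rewrite ellipse_area// /semi_minor /semi_major /focal_vector /= !subrr !mul0r.
rewrite expr0n/= addr0 subr0 (mulrC 2 r) mulfK ?pnatr_eq0//.
by rewrite sqrtr_sqr ger0_norm 1?ltW//; ring.
Qed.

(** * Tritangent circles of a triangle *)

Lemma dist_sym (R : realType) (A B : plane R) : dist A B = dist B A.
Proof. by rewrite /dist; congr Num.sqrt; ring. Qed.

Definition dotp (R : realType) (A B C : plane R) : R :=
  (B.1 - A.1) * (C.1 - A.1) + (B.2 - A.2) * (C.2 - A.2).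

(** Twice the signed area of the triangle. *)
Definition cross (R : realType) (A B C : plane R) : R :=
  (B.1 - A.1) * (C.2 - A.2) - (B.2 - A.2) * (C.1 - A.1).

Lemma cross_rot (R : realType) (A B C : plane R) : cross B C A = cross A B C.
Proof. by rewrite /cross; ring. Qed.

Lemma cross_swap (R : realType) (A B C : plane R) : cross A C B = - cross A B C.
Proof. by rewrite /cross; ring. Qed.

Lemma law_of_cosines (R : realType) (A B C : plane R) :
  dotp A B C = (dist A B ^+ 2 + dist A C ^+ 2 - dist B C ^+ 2) / 2.
Proof. by rewrite !dist_sqr /dotp; field. Qed.

Lemma lagrange_identity (R : realType) (A B C : plane R) :
  cross A B C ^+ 2 + dotp A B C ^+ 2 = dist A B ^+ 2 * dist A C ^+ 2.
Proof. by rewrite !dist_sqr /dotp /cross; ring. Qed.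

(** Only the squares of the sides are prescribed, so that negative signs remain available for
    excircles. *)
Lemma heron (R : realType) (A B C : plane R) (a b c : R) :
  a ^+ 2 = dist B C ^+ 2 -> b ^+ 2 = dist A C ^+ 2 -> c ^+ 2 = dist A B ^+ 2 ->
  4 * cross A B C ^+ 2
  = (a + b + c) * (- a + b + c) * (a - b + c) * (a + b - c).
Proof.
move=> aE bE cE; have := lagrange_identity A B C; rewrite law_of_cosines.
by rewrite -aE -bE -cE => /(canRL (addrK _)) ->; field.
Qed.

(** The projections of [O] on [AB] and [AC] fall at the midpoints; the Gram determinant of the
    vectors from [A] to [B], [C] and [O] vanishes in the plane, which gives the formula. *)
Lemma cross_circumradius (R : realType) (A B C O : plane R) (r : R) :
  dist A O ^+ 2 = r ^+ 2 -> dist B O ^+ 2 = r ^+ 2 -> dist C O ^+ 2 = r ^+ 2 ->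
  4 * cross A B C ^+ 2 * r ^+ 2
  = dist B C ^+ 2 * dist A C ^+ 2 * dist A B ^+ 2.
Proof.
move=> OA OB OC.
have AB : dotp A B O = dist A B ^+ 2 / 2 by rewrite law_of_cosines OA OB addrK.
have AC : dotp A C O = dist A C ^+ 2 / 2 by rewrite law_of_cosines OA OC addrK.
have -> : 4 * cross A B C ^+ 2 * r ^+ 2 = 4 * (dotp A B O ^+ 2 * dist A C ^+ 2
    + dotp A C O ^+ 2 * dist A B ^+ 2
    - 2 * dotp A B O * dotp A C O * dotp A B C).
  by rewrite -OA !dist_sqr /cross /dotp; ring.
by rewrite AB AC law_of_cosines; field.
Qed.

Lemma cross_dist_gt0 (R : realType) (A B C : plane R) :
  cross A B C != 0 -> 0 < dist A B.
Proof.
apply: contraNT; rewrite -leNgt => AB; have /eqP : dist A B = 0.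
  by apply/eqP; rewrite eq_le AB dist_ge0.
by rewrite -sqrf_eq0 dist_sqr paddr_eq0 ?sqr_ge0// !sqrf_eq0 /cross
  => /andP[/eqP x0 /eqP y0]; apply/eqP; nra.
Qed.

Lemma strict_triangle (R : realType) (A B C : plane R) :
  cross A B C != 0 -> dist B C < dist A C + dist A B.
Proof.
move=> X0; have X2 : 0 < cross A B C ^+ 2 by rewrite exprn_even_gt0.
have := lagrange_identity A B C; rewrite law_of_cosines.
move: (dist_ge0 A B) (dist_ge0 A C) (dist_ge0 B C).
move: (dist A B) (dist A C) (dist B C) => c b a c0 b0 a0 L.
rewrite ltNge; apply/negP => abc.
(* By the Lagrange identity these two quantities multiply to [-4 * cross A B C ^+ 2], which is
   negative. *)
have h1 : 0 <= a ^+ 2 - (b + c) ^+ 2 by nra.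
have h2 : 0 <= a ^+ 2 - (b - c) ^+ 2 by nra.
by have := mulr_ge0 h1 h2; lra.
Qed.

(** * Tangency to a circle and tritangent circles *)

Lemma unique_root (R : realType) (a b c t : R) : a != 0 ->
  a * t ^+ 2 + 2 * b * t + c = 0 ->
  (forall s, a * s ^+ 2 + 2 * b * s + c = 0 -> s = t) -> a * t + b = 0.
Proof.
move=> a0 tE /(_ (- (2 * b / a) - t)) ts.
(* By Vieta the left side is again a root, hence [t] is a double root. *)
have : - (2 * b / a) - t = t.
  by apply: ts; rewrite -[RHS]tE; field.
by move=> /(congr1 ( *%R a)); rewrite mulrBr mulrN mulrCA divff// mulr1; lra.
Qed.

Lemma lerp_inj (R : realType) (A B : plane R) : 0 < dist A B ->
  injective (lerp A B).
Proof.
rewrite sqrtr_gt0 => AB s t [] /addrI st1 /addrI st2.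
apply/eqP; rewrite -subr_eq0; apply/negP => /negP st.
have : (s - t) ^+ 2 * ((A.1 - B.1) ^+ 2 + (A.2 - B.2) ^+ 2) = 0 by nra.
by move/eqP; rewrite mulf_eq0 sqrf_eq0 (negbTE st) gt_eqF.
Qed.

(** Along the line the circle has a quadratic equation; its unique root is the foot of the
    perpendicular from the centre, and the second condition is Pythagoras. *)
Lemma tangent_circleP (R : realType) (A B : plane R) (C : circle R) (t : R) :
  0 < dist A B -> 0 < Defs.radius C ->
  tangent_at (line A B) (circle_curve C) (lerp A B t) <->
  dotp A B (Defs.center C) = t * dist A B ^+ 2 /\
  dist A (Defs.center C) ^+ 2
  = Defs.radius C ^+ 2 + t ^+ 2 * dist A B ^+ 2.
Proof.
case: C => O r /= AB r0; have AB2 : dist A B ^+ 2 != 0 by rewrite sqrf_eq0 gt_eqF.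
have circE s : circle_curve (Circle O r) (lerp A B s) <->
    dist A B ^+ 2 * s ^+ 2 + 2 * (- dotp A B O) * s
    + (dist A O ^+ 2 - r ^+ 2) = 0.
  have sE : dist (lerp A B s) O ^+ 2 = dist A B ^+ 2 * s ^+ 2
      + 2 * (- dotp A B O) * s + dist A O ^+ 2.
    by rewrite !dist_sqr /dotp /lerp /=; ring.
  rewrite addrA -sE /circle_curve /=; split=> [->|/eqP]; first by rewrite subrr.
  by rewrite subr_eq0 eqrXn2 ?dist_ge0 ?ltW// => /eqP.
split.
- move=> T; have [tE tu] : circle_curve (Circle O r) (lerp A B t) /\
      forall s, circle_curve (Circle O r) (lerp A B s) -> s = t.
    split=> [|s sE].
      by have [] : (line A B `&` circle_curve (Circle O r)) (lerp A B t) by rewrite T.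
    apply: (lerp_inj AB).
    have : (line A B `&` circle_curve (Circle O r)) (lerp A B s).
      by split=> //; exists s.
    by rewrite T.
  have := unique_root AB2 (proj1 (circE t) tE) (fun s sE => tu s (proj2 (circE s) sE)).
  move=> E; have dE : dotp A B O = t * dist A B ^+ 2 by lra.
  by split=> //; move: tE => /circE; rewrite dE; lra.
- move=> [dE oE]; apply/seteqP; split=> [_ [[s _ <-] /circE]|_ ->] /=.
    rewrite dE oE => sE; have : dist A B ^+ 2 * (s - t) ^+ 2 = 0 by lra.
    by move/eqP; rewrite mulf_eq0 (negbTE AB2) sqrf_eq0 subr_eq0 => /eqP ->.
  by split; [exists t|apply/circE; rewrite dE oE; ring].
Qed.

Lemma dotp_inj (R : realType) (A B C O I : plane R) : cross A B C != 0 ->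
  dotp A B O = dotp A B I -> dotp A C O = dotp A C I -> O = I.
Proof.
case: A B C O I => [a1 a2] [b1 b2] [c1 c2] [p1 p2] [i1 i2].
rewrite /cross /dotp /= => X0 EB EC; congr pair.
  have := congr1 ( *%R (c2 - a2)) EB; have := congr1 ( *%R (b2 - a2)) EC.
  by move=> e1 e2; apply: (mulfI X0); lra.
have := congr1 ( *%R (c1 - a1)) EB; have := congr1 ( *%R (b1 - a1)) EC.
by move=> e1 e2; apply: (mulfI X0); lra.
Qed.

Definition barycenter (R : realType) (A B C : plane R) (x y z : R) : plane R :=
  ((x * A.1 + y * B.1 + z * C.1) / (x + y + z),
   (x * A.2 + y * B.2 + z * C.2) / (x + y + z)).

Lemma barycenter_rot (R : realType) (A B C : plane R) (x y z : R) :
  barycenter B C A y z x = barycenter A B C x y z.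
Proof. by rewrite /barycenter; congr ((_ / _), (_ / _)); ring. Qed.

Lemma barycenter_swap (R : realType) (A B C : plane R) (x y z : R) :
  barycenter A C B x z y = barycenter A B C x y z.
Proof. by rewrite /barycenter; congr ((_ / _), (_ / _)); ring. Qed.

Section TritangentCircle.
Variables (R : realType) (A B C : plane R) (a b c : R).
(* Side lengths up to sign: positive signs give the incircle, one negative
   sign gives an excircle. *)
Hypotheses (aE : a ^+ 2 = dist B C ^+ 2) (bE : b ^+ 2 = dist A C ^+ 2)
  (cE : c ^+ 2 = dist A B ^+ 2) (abc0 : a + b + c != 0).

(** [(b + c - a) / 2] is the signed tangent length from [A]: the centre projects on [AB] to the
    contact point. *)
Lemma tritangent_dotp :
  dotp A B (barycenter A B C a b c) = c * ((b + c - a) / 2).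
Proof.
transitivity ((b * dist A B ^+ 2 + c * dotp A B C) / (a + b + c)).
  by rewrite dist_sqr /dotp /barycenter /=; field.
by rewrite law_of_cosines -aE -bE -cE; field.
Qed.

Lemma tritangent_dist : dist A (barycenter A B C a b c) ^+ 2
  = (cross A B C / (a + b + c)) ^+ 2 + ((b + c - a) / 2) ^+ 2.
Proof.
transitivity ((b ^+ 2 * dist A B ^+ 2 + c ^+ 2 * dist A C ^+ 2
               + 2 * b * c * dotp A B C) / (a + b + c) ^+ 2).
  by rewrite !dist_sqr /dotp /barycenter /=; field.
have X2 : cross A B C ^+ 2 = (a + b + c) * (- a + b + c) * (a - b + c) * (a + b - c) / 4.
  by rewrite -(heron aE bE cE); field.
by rewrite law_of_cosines -aE -bE -cE expr_div_n X2; field.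
Qed.

End TritangentCircle.

(** The scalar products with two independent sides determine the centre; Pythagoras then determines
    the radius. *)
Lemma tritangent_unique (R : realType) (A B C O : plane R) (a b c r : R) :
  a ^+ 2 = dist B C ^+ 2 -> b ^+ 2 = dist A C ^+ 2 -> c ^+ 2 = dist A B ^+ 2 ->
  cross A B C != 0 -> 0 < a + b + c -> 0 < r ->
  dotp A B O = c * ((b + c - a) / 2) -> dotp A C O = b * ((b + c - a) / 2) ->
  dist A O ^+ 2 = r ^+ 2 + ((b + c - a) / 2) ^+ 2 ->
  O = barycenter A B C a b c /\ r = `|cross A B C| / (a + b + c).
Proof.
move=> aE bE cE X0 s0 r0 OB OC OA; have s1 := lt0r_neq0 s0.
have OE : O = barycenter A B C a b c.
  apply: (dotp_inj X0); first by rewrite tritangent_dotp.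
  rewrite OC -barycenter_swap tritangent_dotp ?(addrC c b)//.
    by rewrite dist_sym.
  by rewrite addrAC.
split=> //; apply/eqP; rewrite -(@eqrXn2 _ 2) ?divr_ge0//; try exact: ltW.
move: OA; rewrite OE tritangent_dist// => /addIr <-.
by rewrite !expr_div_n real_normK ?num_real.
Qed.

Lemma tritangent_tangent (R : realType) (A B C : plane R) (a b c : R) :
  a ^+ 2 = dist B C ^+ 2 -> b ^+ 2 = dist A C ^+ 2 -> c ^+ 2 = dist A B ^+ 2 ->
  cross A B C != 0 -> 0 < a + b + c ->
  tangent_at (line A B)
    (circle_curve (Circle (barycenter A B C a b c) (`|cross A B C| / (a + b + c))))
    (lerp A B ((b + c - a) / (2 * c))).
Proof.
move=> aE bE cE X0 s0; have AB := cross_dist_gt0 X0; have s1 := lt0r_neq0 s0.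
have c0 : c != 0 by rewrite -sqrf_eq0 cE sqrf_eq0 gt_eqF.
apply/tangent_circleP => //=; first by rewrite divr_gt0// normr_gt0.
rewrite tritangent_dotp// tritangent_dist// -cE; split; first by field.
by rewrite !expr_div_n real_normK ?num_real//; field; rewrite c0.
Qed.

(** Expresses the powers of both endpoints, so that the two tangents drawn from a common vertex can
    be equated. *)
Lemma tangent_lengths (R : realType) (A B : plane R) (C : circle R) (t : R) :
  0 < dist A B -> 0 < Defs.radius C ->
  tangent_at (line A B) (circle_curve C) (lerp A B t) ->
  [/\ dotp A B (Defs.center C) = dist A B * (t * dist A B),
      dist A (Defs.center C) ^+ 2 = Defs.radius C ^+ 2 + (t * dist A B) ^+ 2 &
      dist B (Defs.center C) ^+ 2 = Defs.radius C ^+ 2 + ((1 - t) * dist A B) ^+ 2].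
Proof.
move=> AB r0 /(tangent_circleP _ AB r0) [dE aE]; split; first by rewrite dE; ring.
  by rewrite aE exprMn.
have -> : dist B (Defs.center C) ^+ 2 = dist A (Defs.center C) ^+ 2
    - 2 * dotp A B (Defs.center C) + dist A B ^+ 2.
  by rewrite !dist_sqr /dotp; ring.
by rewrite aE dE; ring.
Qed.

Lemma eq_tangent_length (R : realType) (d r x y : R) : 0 <= x -> 0 <= y ->
  d = r + x ^+ 2 -> d = r + y ^+ 2 -> x = y.
Proof.
by move=> x0 y0 -> /addrI /eqP; rewrite eqrXn2// => /eqP.
Qed.

(** * Excircles, incircle and circumcircle of a triangle *)

Lemma ordSS3 (i : 'I_3) : ordS (ordS i) = ord_pred i.
Proof. by apply/val_inj; case: i => [[|[|[|]]]]. Qed.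

Lemma ord_pred_pred3 (i : 'I_3) : ord_pred (ord_pred i) = ordS i.
Proof. by apply/val_inj; case: i => [[|[|[|]]]]. Qed.

Lemma neq_ord3 (i j : 'I_3) : j != i -> j = ordS i \/ j = ord_pred i.
Proof.
by case: i j => [[|[|[|]]]] // ? [[|[|[|]]]] // ? ji; [> left|right|right|left|left|right];
  apply/val_inj.
Qed.

Section TriangleCircles.
Variables (R : realType) (P : 'I_3 -> plane R).
Hypothesis hP : is_triangle P.

Definition vcross (i : 'I_3) : R := cross (P i) (P (ordS i)) (P (ord_pred i)).
Definition opp_side (i : 'I_3) : R := dist (P (ordS i)) (P (ord_pred i)).

Lemma vcrossS i : vcross (ordS i) = vcross i.
Proof. by rewrite /vcross ordSK ordSS3 cross_rot. Qed.

Lemma vcross_neq0 i : vcross i != 0.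
Proof.
have V0 : vcross ord0 != 0.
  have [Pinj PL] := hP; apply/negP => /eqP X0; apply: PL.
  have P12 : P (ordS ord0) <> P (ord_pred ord0) by move/Pinj.
  exists (dotp (P (ordS ord0)) (P (ord_pred ord0)) (P ord0)
          / dist (P (ordS ord0)) (P (ord_pred ord0)) ^+ 2) => //.
  move: X0 P12; rewrite /vcross /dotp dist_sqr /lerp /cross.
  case: (P ord0) (P (ordS ord0)) (P (ord_pred ord0))
    => [p1 p2] [q1 q2] [s1 s2] /= X0 P12.
  have d0 : (q1 - s1) ^+ 2 + (q2 - s2) ^+ 2 != 0.
    rewrite paddr_eq0 ?sqr_ge0// !sqrf_eq0 !subr_eq0; apply/negP.
    by move=> /andP[/eqP e1 /eqP e2]; apply: P12; rewrite e1 e2.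
  congr pair; apply: (mulfI d0); rewrite mulrDr mulrA mulrCA divff// mulr1.
    by have := congr1 ( *%R (s2 - q2)) X0; lra.
  by have := congr1 ( *%R (s1 - q1)) X0; lra.
have V1 := V0; rewrite -vcrossS in V1; have V2 := V1; rewrite -vcrossS in V2.
case: i => [[|[|[|]]]] // i3.
- by rewrite (_ : Ordinal i3 = ord0)//; exact/val_inj.
- by rewrite (_ : Ordinal i3 = ordS ord0)//; exact/val_inj.
- by rewrite (_ : Ordinal i3 = ordS (ordS ord0))//; exact/val_inj.
Qed.

Lemma opp_side_gt0 i : 0 < opp_side i.
Proof.
apply: (@cross_dist_gt0 _ _ _ (P i)).
by rewrite cross_rot vcross_neq0.
Qed.

Lemma opp_sideS i : dist (P i) (P (ord_pred i)) = opp_side (ordS i).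
Proof. by rewrite /opp_side ordSS3 ordSK dist_sym. Qed.

Lemma opp_sideP i : dist (P i) (P (ordS i)) = opp_side (ord_pred i).
Proof. by rewrite /opp_side ord_predK ord_pred_pred3. Qed.

Lemma opp_side_lt i : opp_side i < opp_side (ordS i) + opp_side (ord_pred i).
Proof.
by rewrite -opp_sideS -opp_sideP; exact: strict_triangle (vcross_neq0 i).
Qed.

Definition perimeter : R := \sum_i opp_side i.

Lemma perimeterE i :
  perimeter = opp_side i + opp_side (ordS i) + opp_side (ord_pred i).
Proof.
rewrite /perimeter !big_ord_recl big_ord0 addr0.
have [-> ->] : lift ord0 ord0 = ordS ord0 :> 'I_3 /\
    lift ord0 (lift ord0 ord0) = ord_pred ord0 :> 'I_3.
  by split; apply/val_inj.
case: i => [[|[|[|]]]] // i3.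
- by rewrite (_ : Ordinal i3 = ord0); [rewrite addrA|exact/val_inj].
- rewrite (_ : Ordinal i3 = ordS ord0); last exact/val_inj.
  by rewrite ordSS3 ordSK; ring.
- rewrite (_ : Ordinal i3 = ord_pred ord0); last exact/val_inj.
  by rewrite ord_predK ord_pred_pred3; ring.
Qed.

Lemma perimeter_gt0 : 0 < perimeter.
Proof. by rewrite (perimeterE ord0) !addr_gt0 ?opp_side_gt0. Qed.

Lemma excircle_unique i C : is_excircle P i C ->
  Defs.center C = barycenter (P i) (P (ordS i)) (P (ord_pred i))
    (- opp_side i) (opp_side (ordS i)) (opp_side (ord_pred i)) /\
  Defs.radius C = `|vcross i|
    / (- opp_side i + opp_side (ordS i) + opp_side (ord_pred i)).
Proof.
move=> [r0 [t0 t01 T0] Tj].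
have [t1 t1_gt1 T1] := Tj (ordS i) ltac:(by case: i {T0 Tj} => [[|[|[|]]]]).
have [t2 t2_gt1 T2] := Tj (ord_pred i) ltac:(by case: i {T0 T1 Tj} => [[|[|[|]]]]).
have [t0_ge0 t0_le1] : 0 <= t0 /\ 0 <= 1 - t0 by lra.
have [t1_ge0 t1_ge1] : 0 <= t1 /\ 0 <= t1 - 1 by lra.
have [t2_ge0 t2_ge1] : 0 <= t2 /\ 0 <= t2 - 1 by lra.
have a0 := opp_side_gt0 i; have b0 := opp_side_gt0 (ordS i).
have c0 := opp_side_gt0 (ord_pred i); have abc := opp_side_lt i.
have s0 : 0 < - opp_side i + opp_side (ordS i) + opp_side (ord_pred i) by lra.
have bE := opp_sideS i; have cE := opp_sideP i.
have [_ B0 C0] := tangent_lengths a0 r0 T0.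
have c0' := c0; rewrite -cE in c0'.
have [AB A1 B1] := tangent_lengths c0' r0 T1.
have b0' := b0; rewrite -bE in b0'.
have [AC A2 C2] := tangent_lengths b0' r0 T2.
rewrite ?bE ?cE -?/(opp_side i) in AB AC A1 B1 A2 C2 B0 C0.
(* Contact occurs beyond the far endpoints, so the tangent lengths there are [t1 - 1] and [t2 - 1]
   times the sides. Equating the tangents from each vertex gives a linear system whose solution
   makes the tangent length from [P i] the semiperimeter. *)
rewrite -(opprB t1 1) mulNr sqrrN in B1; rewrite -(opprB t2 1) mulNr sqrrN in C2.
have eA := eq_tangent_length (mulr_ge0 t1_ge0 (ltW c0)) (mulr_ge0 t2_ge0 (ltW b0)) A1 A2.
have eB := eq_tangent_length (mulr_ge0 t0_ge0 (ltW a0)) (mulr_ge0 t1_ge1 (ltW c0)) B0 B1.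
have eC := eq_tangent_length (mulr_ge0 t0_le1 (ltW a0)) (mulr_ge0 t2_ge1 (ltW b0)) C0 C2.
have lE : t1 * opp_side (ord_pred i)
    = (opp_side (ordS i) + opp_side (ord_pred i) - - opp_side i) / 2.
  by clear -eA eB eC; lra.
apply: tritangent_unique => //.
- by rewrite sqrrN.
- by rewrite bE.
- by rewrite cE.
- exact: vcross_neq0.
- by rewrite AB lE.
- by rewrite AC -eA lE.
- by rewrite A1 lE.
Qed.

Lemma incircle_unique C : is_incircle P C ->
  Defs.radius C = `|vcross ord0| / perimeter.
Proof.
pose i : 'I_3 := ord0; rewrite -/i.
move=> [r0 T].
have [t0 t01 T0] := T i; have [t1 t11 T1] := T (ordS i).
have [t2 t21 T2] := T (ord_pred i).
have [t0_ge0 t0_le1] : 0 <= t0 /\ 0 <= 1 - t0 by lra.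
have [t1_ge0 t1_le1] : 0 <= t1 /\ 0 <= 1 - t1 by lra.
have [t2_ge0 t2_le1] : 0 <= t2 /\ 0 <= 1 - t2 by lra.
have a0 := opp_side_gt0 i; have b0 := opp_side_gt0 (ordS i).
have c0 := opp_side_gt0 (ord_pred i); have abc := opp_side_lt i.
have bE := opp_sideS i; have cE := opp_sideP i.
have [_ B0 C0] := tangent_lengths a0 r0 T0.
have [AC C1 A1] := tangent_lengths b0 r0 T1.
have [AB A2 B2] := tangent_lengths c0 r0 T2.
have iE := (ordSS3 i, ordSK i, ord_predK i, ord_pred_pred3 i).
have bE' := bE; rewrite dist_sym in bE'.
rewrite ?iE ?bE' ?cE -?/(opp_side _) in AB AC A1 A2 B0 B2 C0 C1.
have eA := eq_tangent_length (mulr_ge0 t2_ge0 (ltW c0)) (mulr_ge0 t1_le1 (ltW b0)) A2 A1.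
have eB := eq_tangent_length (mulr_ge0 t0_ge0 (ltW a0)) (mulr_ge0 t2_le1 (ltW c0)) B0 B2.
have eC := eq_tangent_length (mulr_ge0 t0_le1 (ltW a0)) (mulr_ge0 t1_ge0 (ltW b0)) C0 C1.
(* Equal tangents make the tangent length from [P i] the semiperimeter minus the opposite side. *)
have lE : t2 * opp_side (ord_pred i)
    = (opp_side (ordS i) + opp_side (ord_pred i) - opp_side i) / 2.
  by clear -eA eB eC; lra.
have [|||||||||_ ->] := @tritangent_unique R (P i) (P (ordS i)) (P (ord_pred i))
  (Defs.center C) (opp_side i) (opp_side (ordS i)) (opp_side (ord_pred i))
  (Defs.radius C) => //.
- by rewrite bE.
- by rewrite cE.
- exact: vcross_neq0.
- by rewrite -perimeterE perimeter_gt0.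
- by rewrite AB lE.
(* This side was parametrised towards [P i], so the scalar product based at [P i] is recovered from
   distances. *)
- rewrite law_of_cosines bE C1 A1 -eA.
  have -> : t1 * opp_side (ordS i) = opp_side (ordS i) - t2 * opp_side (ord_pred i).
    by clear -eA; lra.
  by rewrite lE; field.
- by rewrite A2 lE.
- by rewrite -perimeterE.
Qed.

Definition tritangent_circle (i : 'I_3) (a b c : R) : circle R :=
  Circle (barycenter (P i) (P (ordS i)) (P (ord_pred i)) a b c)
         (`|vcross i| / (a + b + c)).

Lemma excircle_exists i : is_excircle P i
  (tritangent_circle i (- opp_side i) (opp_side (ordS i)) (opp_side (ord_pred i))).
Proof.
have a0 := opp_side_gt0 i; have b0 := opp_side_gt0 (ordS i).
have c0 := opp_side_gt0 (ord_pred i); have abc := opp_side_lt i.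
have bac := opp_side_lt (ordS i); have cab := opp_side_lt (ord_pred i).
rewrite ordSS3 ordSK in bac; rewrite ord_predK ord_pred_pred3 in cab.
have V0 := vcross_neq0 i.
have bE := opp_sideS i; have cE := opp_sideP i.
have aE2 : (- opp_side i) ^+ 2 = dist (P (ordS i)) (P (ord_pred i)) ^+ 2.
  by rewrite sqrrN.
have bE2 : opp_side (ordS i) ^+ 2 = dist (P i) (P (ord_pred i)) ^+ 2 by rewrite bE.
have cE2 : opp_side (ord_pred i) ^+ 2 = dist (P i) (P (ordS i)) ^+ 2 by rewrite cE.
have s0 : 0 < - opp_side i + opp_side (ordS i) + opp_side (ord_pred i) by lra.
split.
- by rewrite divr_gt0// normr_gt0.
(* The tangency lemma is applied after a rotation of the letters. With [a], [b], [c] opposite to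
   [P i], its successor and its predecessor, the parameter is [(a + b - c) / (2 a)], between 0 and 1
   by the triangle inequalities. *)
- exists ((opp_side (ord_pred i) + - opp_side i - opp_side (ordS i))
          / (2 * - opp_side i)).
    by rewrite mulrN invrN mulrN -mulNr divr_gt0 ?ltr_pdivrMr; lra.
  rewrite /tritangent_circle /vcross -barycenter_rot -cross_rot.
  rewrite (_ : _ + _ + _ = opp_side (ordS i) + opp_side (ord_pred i) + - opp_side i);
    last by ring.
  apply: tritangent_tangent => //.
  + by rewrite dist_sym.
  + by rewrite dist_sym.
  + by rewrite cross_rot.
  + by lra.
- move=> j /neq_ord3[->|->].
    exists ((opp_side (ordS i) + opp_side (ord_pred i) - - opp_side i)
          / (2 * opp_side (ord_pred i))).
      by rewrite ltr_pdivlMr; lra.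
    exact: tritangent_tangent.
  exists ((opp_side (ord_pred i) + opp_side (ordS i) - - opp_side i)
          / (2 * opp_side (ordS i))).
    by rewrite ltr_pdivlMr; lra.
  (* Exchanging two vertices reverses orientation; the absolute value in the radius absorbs the
     sign. *)
  rewrite /tritangent_circle /vcross -barycenter_swap -normrN -cross_swap addrAC.
  apply: tritangent_tangent => //.
  + by rewrite dist_sym.
  + by rewrite cross_swap oppr_eq0.
  + by lra.
Qed.

Lemma incircle_exists : is_incircle P
  (tritangent_circle ord0 (opp_side ord0) (opp_side (ordS ord0)) (opp_side (ord_pred ord0))).
Proof.
pose i : 'I_3 := ord0; rewrite -/i.
have a0 := opp_side_gt0 i; have b0 := opp_side_gt0 (ordS i).
have c0 := opp_side_gt0 (ord_pred i); have abc := opp_side_lt i.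
have bac := opp_side_lt (ordS i); have cab := opp_side_lt (ord_pred i).
rewrite ordSS3 ordSK in bac; rewrite ord_predK ord_pred_pred3 in cab.
have V0 := vcross_neq0 i.
have bE := opp_sideS i; have cE := opp_sideP i.
have bE2 : opp_side (ordS i) ^+ 2 = dist (P i) (P (ord_pred i)) ^+ 2 by rewrite bE.
have cE2 : opp_side (ord_pred i) ^+ 2 = dist (P i) (P (ordS i)) ^+ 2 by rewrite cE.
have s0 : 0 < opp_side i + opp_side (ordS i) + opp_side (ord_pred i) by lra.
have iE := (ordSS3 i, ordSK i, ord_predK i, ord_pred_pred3 i).
(* Cyclic relabelling preserves the circle, so one tangency lemma serves all three sides. *)
have rotE a b c : tritangent_circle i a b c = tritangent_circle (ordS i) b c a.
  have E : b + c + a = a + b + c by ring.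
  by rewrite /tritangent_circle vcrossS ?iE [in RHS]barycenter_rot E.
split; first by rewrite divr_gt0// normr_gt0.
move=> j; have [->|/neq_ord3[->|->]] := eqVneq j i.
- exists ((opp_side (ord_pred i) + opp_side i - opp_side (ordS i)) / (2 * opp_side i)).
    by rewrite divr_gt0 ?ltr_pdivrMr; lra.
  rewrite rotE /tritangent_circle /vcross ?iE; apply: tritangent_tangent => //.
  + by rewrite dist_sym.
  + by rewrite dist_sym.
  + by rewrite cross_rot.
  + by lra.
- exists ((opp_side i + opp_side (ordS i) - opp_side (ord_pred i)) / (2 * opp_side (ordS i))).
    by rewrite divr_gt0 ?ltr_pdivrMr; lra.
  rewrite rotE /tritangent_circle -vcrossS /vcross ?iE -barycenter_rot.
  rewrite (_ : _ + _ + _ = opp_side (ord_pred i) + opp_side i + opp_side (ordS i));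
    last by ring.
  rewrite /side_line ?iE; apply: tritangent_tangent => //.
  + by rewrite dist_sym.
  + by rewrite dist_sym.
  + by rewrite -cross_rot.
  + by lra.
- exists ((opp_side (ordS i) + opp_side (ord_pred i) - opp_side i) / (2 * opp_side (ord_pred i))).
    by rewrite divr_gt0 ?ltr_pdivrMr; lra.
  by rewrite /side_line ?iE; apply: tritangent_tangent.
Qed.

Lemma circumcircle_unique C : is_circumcircle P C ->
  Defs.radius C = opp_side ord0 * opp_side (ordS ord0) * opp_side (ord_pred ord0)
    / (2 * `|vcross ord0|).
Proof.
pose i : 'I_3 := ord0; rewrite -/i.
case: C => O r [/= r0 Pr]; have X0 := vcross_neq0 i.
have rE j : dist (P j) O ^+ 2 = r ^+ 2 by rewrite (Pr j).
have XE := cross_circumradius (rE i) (rE (ordS i)) (rE (ord_pred i)).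
rewrite -/(vcross i) -/(opp_side i) opp_sideS opp_sideP in XE.
have E : vcross i ^+ 2 * r ^+ 2
    = (opp_side i * opp_side (ordS i) * opp_side (ord_pred i) / 2) ^+ 2.
  by rewrite expr_div_n !exprMn -XE; field.
have a0 := opp_side_gt0 i; have b0 := opp_side_gt0 (ordS i).
have c0 := opp_side_gt0 (ord_pred i).
have X1 : `|vcross i| != 0 by rewrite normr_eq0.
apply: (mulfI X1); apply/eqP; rewrite -(@eqrXn2 _ 2)//.
- rewrite exprMn real_normK ?num_real// E; apply/eqP; field.
  by rewrite normr_eq0.
- by rewrite mulr_ge0// ltW.
- by rewrite mulr_ge0// divr_ge0 ?mulr_ge0// ltW.
Qed.

Lemma dotp_dist0 (A B O : plane R) : dist A O = 0 -> dotp A B O = 0.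
Proof.
case: A B O => [a1 a2] [b1 b2] [p1 p2] AO.
have := dist_sqr (a1, a2) (p1, p2); rewrite AO expr0n/= => /esym/eqP.
rewrite paddr_eq0 ?sqr_ge0// !sqrf_eq0 !subr_eq0 /dotp /= => /andP[/eqP -> /eqP ->].
by rewrite !subrr !mulr0 addr0.
Qed.

Lemma circumcircle_exists : exists C, is_circumcircle P C.
Proof.
pose i : 'I_3 := ord0; have X0 := vcross_neq0 i.
pose b2 := dist (P i) (P (ord_pred i)) ^+ 2 / 2.
pose c2 := dist (P i) (P (ordS i)) ^+ 2 / 2.
(* Cramer's solution for the intersection of two perpendicular bisectors: each scalar product is
   half a squared side. *)
pose O : plane R :=
  ((P i).1 + (c2 * ((P (ord_pred i)).2 - (P i).2) - b2 * ((P (ordS i)).2 - (P i).2)) / vcross i,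
   (P i).2 + (b2 * ((P (ordS i)).1 - (P i).1) - c2 * ((P (ord_pred i)).1 - (P i).1)) / vcross i).
have OB : dotp (P i) (P (ordS i)) O = c2.
  by rewrite /dotp /O /=; move: X0; rewrite /vcross /cross => X0; field.
have OC : dotp (P i) (P (ord_pred i)) O = b2.
  by rewrite /dotp /O /=; move: X0; rewrite /vcross /cross => X0; field.
have c20 : 0 < c2 by rewrite divr_gt0// exprn_gt0// opp_sideP opp_side_gt0.
exists (Circle O (dist (P i) O)); split=> /=.
  rewrite lt_neqAle dist_ge0 andbT eq_sym; apply/negP => /eqP O0.
  by move: c20; rewrite -OB dotp_dist0// ltxx.
have distE A : dist A O ^+ 2 = dist (P i) O ^+ 2 + dist (P i) A ^+ 2 - 2 * dotp (P i) A O.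
  by rewrite !dist_sqr /dotp; ring.
have eqd A : dotp (P i) A O = dist (P i) A ^+ 2 / 2 -> dist A O = dist (P i) O.
  move=> E; apply/eqP; rewrite -(@eqrXn2 _ 2) ?dist_ge0// distE E.
  by apply/eqP; field.
move=> j; rewrite /circle_curve /=.
by have [->//|/neq_ord3[->|->]] := eqVneq j i; apply: eqd.
Qed.

End TriangleCircles.

(** * Circumellipses centred at the excenters *)

(* The matrix Q = ((p, q), (q, r)) has eigenvalues A^2 and B^2, and the focal
   vector f is given by Q = B^2 + f f^T; the form below is the adjugate of Q. *)
Lemma ellipse_of_form (R : realType) (c : plane R) (p q r : R) :
  0 < p + r -> 0 < p * r - q ^+ 2 ->
  exists E : ellipse R, [/\ is_ellipse E, ellipse_center E = c,
    forall v, ellipse_form E v = r * v.1 ^+ 2 - 2 * q * v.1 * v.2 + p * v.2 ^+ 2 &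
    (semi_major E * semi_minor E) ^+ 2 = p * r - q ^+ 2].
Proof.
move=> tr0 det0; set s := Num.sqrt ((p - r) ^+ 2 + 4 * q ^+ 2).
have s2 : s ^+ 2 = (p - r) ^+ 2 + 4 * q ^+ 2.
  by rewrite sqr_sqrtr//; have := sqr_ge0 (p - r); have := sqr_ge0 q; lra.
have s0 : 0 <= s by rewrite sqrtr_ge0.
have s_lt : s < p + r.
  by rewrite -ltr_sqr ?nnegrE//; [rewrite s2; lra|exact: ltW].
have q2 := sqr_ge0 q.
have pr : p - r <= s by rewrite leNgt; apply/negP => h; nra.
have rp : r - p <= s by rewrite leNgt; apply/negP => h; nra.
set f := Num.sqrt ((p - r + s) / 2).
have f2 : f ^+ 2 = (p - r + s) / 2 by rewrite sqr_sqrtr// divr_ge0//; lra.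
have [g g2 fg] : exists2 g, g ^+ 2 = (r - p + s) / 2 & f * g = q.
  set g := Num.sqrt ((r - p + s) / 2).
  have g2 : g ^+ 2 = (r - p + s) / 2 by rewrite sqr_sqrtr// divr_ge0//; lra.
  have : (f * g) ^+ 2 = q ^+ 2.
    rewrite exprMn f2 g2; transitivity ((s ^+ 2 - (p - r) ^+ 2) / 4); first by field.
    by rewrite s2; field.
  move/eqP; rewrite eqf_sqr => /orP[/eqP fg|/eqP fg]; first by exists g.
  by exists (- g); rewrite ?sqrrN// mulrN fg opprK.
set A := Num.sqrt ((p + r + s) / 2).
have A2 : A ^+ 2 = (p + r + s) / 2 by rewrite sqr_sqrtr// divr_ge0//; lra.
have A0 : 0 <= A by rewrite sqrtr_ge0.
pose E := Ellipse (c.1 + f, c.2 + g) (c.1 - f, c.2 - g) (2 * A).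
have AE : semi_major E = A by rewrite /semi_major /= mulrC mulKf ?pnatr_eq0.
have fE : focal_vector E = (f, g).
  by rewrite /focal_vector /=; congr pair; field.
have hE : is_ellipse E.
  rewrite /is_ellipse -ltr_sqr ?nnegrE ?dist_ge0 ?mulr_ge0// dist_sqr /=.
  rewrite exprMn A2; have -> : (c.1 + f - (c.1 - f)) ^+ 2 + (c.2 + g - (c.2 - g)) ^+ 2
    = 4 * (f ^+ 2 + g ^+ 2) by ring.
  by rewrite f2 g2; lra.
exists E; split=> //.
- by rewrite /ellipse_center /midpoint /lerp /=; case: c @E {AE fE hE} => c1 c2 /=;
    congr pair; field.
- move=> v; rewrite /ellipse_form AE fE /= -fg.
  have rE : r = A ^+ 2 - f ^+ 2 by rewrite A2 f2; lra.
  have pE : p = A ^+ 2 - g ^+ 2 by rewrite A2 g2; lra.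
  by rewrite rE pE; ring.
- rewrite exprMn semi_minor_sqr// AE fE /= A2 f2 g2.
  transitivity (((p + r) ^+ 2 - s ^+ 2) / 4); first by field.
  by rewrite s2; field.
Qed.

(** Expanding the norm of [a] times the first radius gives the polar product [g] of the other two.
    Their Gram determinant [N ^+ 2 - g ^+ 2] is [p * r - q ^+ 2] times their squared cross product.
    Determinant and level agree, both being [N], as they do for [ellipse_form]. *)
Lemma conic_gram (R : realType) (p q r N a b c x1 y1 x2 y2 x3 y3 : R) :
  a * x1 = b * x2 + c * x3 -> a * y1 = b * y2 + c * y3 ->
  p * x1 ^+ 2 - 2 * q * x1 * y1 + r * y1 ^+ 2 = N ->
  p * x2 ^+ 2 - 2 * q * x2 * y2 + r * y2 ^+ 2 = N ->
  p * x3 ^+ 2 - 2 * q * x3 * y3 + r * y3 ^+ 2 = N ->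
  p * r - q ^+ 2 = N -> N != 0 ->
  N * (4 * b ^+ 2 * c ^+ 2 - (a ^+ 2 - b ^+ 2 - c ^+ 2) ^+ 2)
  = 4 * b ^+ 2 * c ^+ 2 * (x2 * y3 - x3 * y2) ^+ 2.
Proof.
move=> xE yE N1 N2 N3 NE N0.
set g := p * x2 * x3 - q * (x2 * y3 + x3 * y2) + r * y2 * y3.
have gE : N * (a ^+ 2 - b ^+ 2 - c ^+ 2) = 2 * b * c * g.
  have : a ^+ 2 * N = b ^+ 2 * N + c ^+ 2 * N + 2 * b * c * g; last by lra.
  transitivity (p * (a * x1) ^+ 2 - 2 * q * (a * x1) * (a * y1) + r * (a * y1) ^+ 2).
    by rewrite -N1; ring.
  by rewrite xE yE -{1}N2 -N3 /g; ring.
apply: (mulfI N0).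
have -> : N * (N * (4 * b ^+ 2 * c ^+ 2 - (a ^+ 2 - b ^+ 2 - c ^+ 2) ^+ 2))
    = 4 * b ^+ 2 * c ^+ 2 * (N * N) - (N * (a ^+ 2 - b ^+ 2 - c ^+ 2)) ^+ 2 by ring.
have key : N * N - g ^+ 2 = N * (x2 * y3 - x3 * y2) ^+ 2.
  rewrite -[X in X * _ ^+ 2]NE; transitivity
    ((p * x2 ^+ 2 - 2 * q * x2 * y2 + r * y2 ^+ 2)
     * (p * x3 ^+ 2 - 2 * q * x3 * y3 + r * y3 ^+ 2) - g ^+ 2).
    by rewrite N2 N3.
  by rewrite /g; ring.
transitivity (4 * b ^+ 2 * c ^+ 2 * (N * N - g ^+ 2)); first by rewrite gE; ring.
by rewrite key; ring.
Qed.

Lemma conic_through (R : realType) (x2 y2 x3 y3 g : R) : g ^+ 2 < 1 ->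
  x2 * y3 - x3 * y2 != 0 ->
  exists p q r : R, [/\ 0 < p + r, 0 < p * r - q ^+ 2 &
   forall b c, r * (b * x2 + c * x3) ^+ 2
               - 2 * q * (b * x2 + c * x3) * (b * y2 + c * y3)
               + p * (b * y2 + c * y3) ^+ 2
     = (p * r - q ^+ 2) * (b ^+ 2 + c ^+ 2 + 2 * b * c * g)].
Proof.
move=> g1 X0; set k := 1 - g ^+ 2; have k0 : 0 < k by rewrite subr_gt0.
have k1 : 1 - g ^+ 2 != 0 by exact: lt0r_neq0.
have coef_ge0 x y : 0 <= (x ^+ 2 + y ^+ 2 - 2 * g * x * y) / k.
  have -> : x ^+ 2 + y ^+ 2 - 2 * g * x * y = (x - g * y) ^+ 2 + k * y ^+ 2.
    by rewrite /k; ring.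
  apply: divr_ge0 (ltW k0); apply: addr_ge0; first exact: sqr_ge0.
  exact: mulr_ge0 (ltW k0) (sqr_ge0 _).
(* The matrix [((p, q), (q, r))] is [V G^-1 V^T], where [V] has the two given vectors as columns and
   [G = ((1, g), (g, 1))]. Its inverse has Gram matrix [G] on these vectors, and its adjugate is the
   determinant times the inverse. *)
set p := (x2 ^+ 2 + x3 ^+ 2 - 2 * g * x2 * x3) / k.
set q := (x2 * y2 + x3 * y3 - g * (x2 * y3 + x3 * y2)) / k.
set r := (y2 ^+ 2 + y3 ^+ 2 - 2 * g * y2 * y3) / k.
have det0 : 0 < p * r - q ^+ 2.
  have -> : p * r - q ^+ 2 = (x2 * y3 - x3 * y2) ^+ 2 / k.
    by rewrite /p /q /r /k; field.
  by rewrite divr_gt0// exprn_even_gt0.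
exists p, q, r; split=> //.
- have p0 : 0 <= p by exact: coef_ge0.
  have r0 : 0 <= r by exact: coef_ge0.
  have q0 := sqr_ge0 q; rewrite ltNge; apply/negP => tr0.
  have pE : p = 0 by lra.
  by move: det0; rewrite pE; lra.
- by move=> b c; rewrite /p /q /r /k; field.
Qed.

Section BarycenterRelations.
Variables (R : realType) (A B C : plane R) (a b c : R).
Hypothesis s0 : a + b + c != 0.
Let O := barycenter A B C a b c.

Lemma barycenter_balance1 : - a * (A.1 - O.1) = b * (B.1 - O.1) + c * (C.1 - O.1).
Proof. by rewrite /O /barycenter /=; field. Qed.

Lemma barycenter_balance2 : - a * (A.2 - O.2) = b * (B.2 - O.2) + c * (C.2 - O.2).
Proof. by rewrite /O /barycenter /=; field. Qed.

Lemma barycenter_cross :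
  (B.1 - O.1) * (C.2 - O.2) - (C.1 - O.1) * (B.2 - O.2)
  = a * cross A B C / (a + b + c).
Proof. by rewrite /O /barycenter /cross /=; field. Qed.

End BarycenterRelations.

(** * Existence, axes and area ratios of the excentral circumellipses *)

Section Circumellipse.
Variables (R : realType) (P : 'I_3 -> plane R).
Hypothesis hP : is_triangle P.

(** Twice the semiperimeter minus a side, the denominator of the exradius. *)
Definition exsemi (i : 'I_3) : R :=
  - opp_side P i + opp_side P (ordS i) + opp_side P (ord_pred i).

Lemma exsemi_gt0 i : 0 < exsemi i.
Proof. by have := opp_side_lt hP i; rewrite /exsemi; lra. Qed.

Lemma excircleP i : is_excircle P i (excircle P i).
Proof. by apply: (@getPex _ (is_excircle P i)); exists (tritangent_circle P i
  (- opp_side P i) (opp_side P (ordS i)) (opp_side P (ord_pred i)));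
  exact: excircle_exists. Qed.

Lemma excenterE i : excenter P i = barycenter (P i) (P (ordS i)) (P (ord_pred i))
  (- opp_side P i) (opp_side P (ordS i)) (opp_side P (ord_pred i)).
Proof. by have [] := excircle_unique hP (excircleP i). Qed.

Lemma cross_opp_sides i :
  4 * opp_side P (ordS i) ^+ 2 * opp_side P (ord_pred i) ^+ 2
  - (opp_side P i ^+ 2 - opp_side P (ordS i) ^+ 2 - opp_side P (ord_pred i) ^+ 2) ^+ 2
  = 4 * vcross P i ^+ 2.
Proof.
have := lagrange_identity (P i) (P (ordS i)) (P (ord_pred i)).
rewrite law_of_cosines opp_sideS opp_sideP -/(opp_side P i) -/(vcross P i).
by move=> /(canRL (addrK _)) ->; field.
Qed.

Lemma circumellipse_exists i : exists E, is_circumellipse_at P (excenter P i) E.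
Proof.
have s0 := lt0r_neq0 (exsemi_gt0 i); rewrite /exsemi in s0.
have a0 := opp_side_gt0 hP i; have b0 := opp_side_gt0 hP (ordS i).
have c0 := opp_side_gt0 hP (ord_pred i).
have e1 := barycenter_balance1 (P i) (P (ordS i)) (P (ord_pred i)) s0.
have e2 := barycenter_balance2 (P i) (P (ordS i)) (P (ord_pred i)) s0.
have e3 := barycenter_cross (P i) (P (ordS i)) (P (ord_pred i)) s0.
have X2 := cross_opp_sides i; have X0 := vcross_neq0 hP i.
rewrite -excenterE opprK -/(vcross P i) in e1 e2 e3.
set a := opp_side P i in s0 a0 e1 e2 e3 X2.
set b := opp_side P (ordS i) in s0 b0 e1 e2 e3 X2.
set c := opp_side P (ord_pred i) in s0 c0 e1 e2 e3 X2.
set O := excenter P i in e1 e2 e3 *.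
(* The value forced by [a v1 = b v2 + c v3] when the three radii have norm 1. It is minus the cosine
   of the angle at [P i], so nondegeneracy gives [g ^+ 2 < 1]. *)
pose g := (a ^+ 2 - b ^+ 2 - c ^+ 2) / (2 * b * c).
have a1 := lt0r_neq0 a0; have b1 := lt0r_neq0 b0; have c1 := lt0r_neq0 c0.
have g1 : g ^+ 2 < 1.
  rewrite /g expr_div_n ltr_pdivrMr ?mul1r ?exprn_gt0 ?mulr_gt0// -subr_gt0.
  have -> : (2 * b * c) ^+ 2 - (a ^+ 2 - b ^+ 2 - c ^+ 2) ^+ 2 = 4 * vcross P i ^+ 2.
    by rewrite -X2; ring.
  by rewrite mulr_gt0// exprn_even_gt0.
have [|p [q [r [tr0 det0 formE]]]] := @conic_through R
  ((P (ordS i)).1 - O.1) ((P (ordS i)).2 - O.2)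
  ((P (ord_pred i)).1 - O.1) ((P (ord_pred i)).2 - O.2) g g1.
  by rewrite e3 mulf_neq0 ?invr_neq0// mulf_neq0// oppr_eq0.
have [E [hE Ec Ef EN]] := ellipse_of_form O tr0 det0.
exists E; split=> // j; apply/(ellipse_curveE hE).
rewrite Ef EN /from_center Ec /=.
have [->|/neq_ord3[->|->]] := eqVneq j i.
- have -> : (P i).1 - O.1 = b / a * ((P (ordS i)).1 - O.1) + c / a * ((P (ord_pred i)).1 - O.1).
    by apply: (mulfI a1); rewrite e1; field.
  have -> : (P i).2 - O.2 = b / a * ((P (ordS i)).2 - O.2) + c / a * ((P (ord_pred i)).2 - O.2).
    by apply: (mulfI a1); rewrite e2; field.
  by rewrite formE /g; field; rewrite a1 b1 c1.
- have := formE 1 0; rewrite !mul1r !mul0r !addr0 => ->.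
  by rewrite expr1n expr0n/= mulr0 mul0r !addr0 mulr1.
- have := formE 0 1; rewrite !mul1r !mul0r !add0r => ->.
  by rewrite expr1n expr0n/= mulr0 !mul0r add0r addr0 mulr1.
Qed.

Lemma circumellipse_axes i E : is_circumellipse_at P (excenter P i) E ->
  semi_major E * semi_minor E
  = opp_side P i * opp_side P (ordS i) * opp_side P (ord_pred i) / exsemi i.
Proof.
move=> [hE Ec EP]; have AB0 := mulr_gt0 (semi_major_gt0 hE) (semi_minor_gt0 hE).
have s0 := exsemi_gt0 i; have s1 := lt0r_neq0 s0.
have a0 := opp_side_gt0 hP i; have b0 := opp_side_gt0 hP (ordS i).
have c0 := opp_side_gt0 hP (ord_pred i).
have e1 := barycenter_balance1 (P i) (P (ordS i)) (P (ord_pred i)) s1.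
have e2 := barycenter_balance2 (P i) (P (ordS i)) (P (ord_pred i)) s1.
have e3 := barycenter_cross (P i) (P (ordS i)) (P (ord_pred i)) s1.
have X2 := cross_opp_sides i; have X0 := vcross_neq0 hP i.
rewrite -excenterE -Ec opprK -/(vcross P i) -/(exsemi i) in e1 e2 e3.
have formE Q : ellipse_form E (from_center E Q)
  = (semi_major E ^+ 2 - (focal_vector E).1 ^+ 2) * (from_center E Q).1 ^+ 2
    - 2 * ((focal_vector E).1 * (focal_vector E).2) * (from_center E Q).1 * (from_center E Q).2
    + (semi_major E ^+ 2 - (focal_vector E).2 ^+ 2) * (from_center E Q).2 ^+ 2.
  by rewrite /ellipse_form; ring.
have EP' j := etrans (esym (formE (P j))) (proj1 (ellipse_curveE hE _) (EP j)).
have NE : (semi_major E ^+ 2 - (focal_vector E).1 ^+ 2)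
    * (semi_major E ^+ 2 - (focal_vector E).2 ^+ 2)
    - ((focal_vector E).1 * (focal_vector E).2) ^+ 2
    = (semi_major E * semi_minor E) ^+ 2.
  by rewrite (exprMn _ (semi_major E)) semi_minor_sqr//; ring.
have N0 : (semi_major E * semi_minor E) ^+ 2 != 0 by rewrite sqrf_eq0 gt_eqF.
(* With [X] for [vcross P i] and [D] for [exsemi i], the side factor is [4 X^2] and the cross
   product of the radii is [- a X / D]; hence the squared product of the semi-axes is
   [(a b c / D)^2]. *)
have := conic_gram e1 e2 (EP' i) (EP' (ordS i)) (EP' (ord_pred i)) NE N0.
rewrite X2 e3 => G; apply/eqP; rewrite -(@eqrXn2 _ 2) ?(ltW AB0)//; last first.
  by rewrite divr_ge0 ?mulr_ge0// ltW.
have V0 : 4 * vcross P i ^+ 2 != 0 by rewrite mulf_neq0 ?pnatr_eq0// sqrf_eq0.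
by apply/eqP/(mulIf V0); rewrite G; field.
Qed.

Lemma area_ratio i : circumellipse_area P i / excircle_area P i
  = opp_side P i * opp_side P (ordS i) * opp_side P (ord_pred i) * exsemi i
    / vcross P i ^+ 2.
Proof.
(* [get] satisfies its predicate once existence is known. The order of the foci it selects does not
   affect the product of the semi-axes. *)
have hC : is_circumellipse_at P (excenter P i) (circumellipse P (excenter P i)).
  exact: (@getPex _ (is_circumellipse_at P (excenter P i)) (circumellipse_exists i)).
have [hE _ _] := hC; have [r0 _ _] := excircleP i.
rewrite /circumellipse_area /excircle_area disk_area// ellipse_area//.
have [_ rE] := excircle_unique hP (excircleP i).
rewrite -(mulrA 2) (circumellipse_axes hC) rE -/(exsemi i) expr_div_n.
rewrite real_normK ?num_real//.
have := semidisk_area_gt0 R; have := exsemi_gt0 i; have := vcross_neq0 hP i.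
by move=> X0 /lt0r_neq0 s0 /lt0r_neq0 k0; field; rewrite X0 s0.
Qed.

Lemma vcross_sqr i : vcross P i ^+ 2 = vcross P ord0 ^+ 2.
Proof.
have [->//|/neq_ord3[->|->]] := eqVneq i ord0; first by rewrite vcrossS.
by rewrite -ordSS3 !vcrossS.
Qed.

Lemma sum_area_ratio :
  \sum_(i < 3) circumellipse_area P i / excircle_area P i
  = opp_side P ord0 * opp_side P (ordS ord0) * opp_side P (ord_pred ord0)
    * perimeter P / vcross P ord0 ^+ 2.
Proof.
pose abc := opp_side P ord0 * opp_side P (ordS ord0) * opp_side P (ord_pred ord0).
have abcE i : opp_side P i * opp_side P (ordS i) * opp_side P (ord_pred i) = abc.
  have [->//|/neq_ord3[->|->]] := eqVneq i ord0.
    by rewrite ordSS3 ordSK /abc; ring.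
  by rewrite ord_predK ord_pred_pred3 /abc; ring.
have exE i : exsemi i = perimeter P - 2 * opp_side P i.
  by rewrite (perimeterE P i) /exsemi; ring.
(* The factors [exsemi i] add up to [3 p - 2 p], where [p] is the perimeter. *)
under eq_bigr do rewrite area_ratio abcE vcross_sqr exE.
rewrite -mulr_suml -mulr_sumr sumrB sumr_const card_ord -mulr_sumr -/(perimeter P).
by rewrite mulr_natl -mulrnBr.
Qed.

Lemma inradius_circumradius :
  2 / (inradius P / circumradius P)
  = opp_side P ord0 * opp_side P (ordS ord0) * opp_side P (ord_pred ord0)
    * perimeter P / vcross P ord0 ^+ 2.
Proof.
have inP : is_incircle P (incircle P).
  by apply: (@getPex _ (is_incircle P)); eexists; exact: incircle_exists.
have circP : is_circumcircle P (circumcircle P).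
  exact: (@getPex _ (is_circumcircle P) (circumcircle_exists hP)).
rewrite /inradius /circumradius (incircle_unique hP inP) (circumcircle_unique hP circP).
have X0 : `|vcross P ord0| != 0 by rewrite normr_eq0 vcross_neq0.
have p0 := lt0r_neq0 (perimeter_gt0 hP).
have a0 := lt0r_neq0 (opp_side_gt0 hP ord0).
have b0 := lt0r_neq0 (opp_side_gt0 hP (ordS ord0)).
have c0 := lt0r_neq0 (opp_side_gt0 hP (ord_pred ord0)).
rewrite -[vcross P ord0 ^+ 2](@real_normK _ (vcross P ord0)) ?num_real//.
by field; rewrite X0 p0 a0 b0 c0.
Qed.

End Circumellipse.

(** * Triangles inscribed in an ellipse and tangent to a confocal one *)

Section UnitChords.
Variables (R : realType).
Implicit Types (c s : R).

(* Half-angle identities for a chord of the unit circle, freed of the angles. *)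
Lemma unit_chord1 c1 s1 c2 s2 : c1 ^+ 2 + s1 ^+ 2 = 1 -> c2 ^+ 2 + s2 ^+ 2 = 1 ->
  (c1 - c2) ^+ 2 = (1 - (c1 * c2 + s1 * s2)) * (1 - (c1 * c2 - s1 * s2)).
Proof.
move=> u1 u2.
have -> : (1 - (c1 * c2 + s1 * s2)) * (1 - (c1 * c2 - s1 * s2))
  = 1 - 2 * c1 * c2 + c1 ^+ 2 * c2 ^+ 2 - s1 ^+ 2 * s2 ^+ 2 by ring.
have -> : s1 ^+ 2 = 1 - c1 ^+ 2 by rewrite -u1; ring.
have -> : s2 ^+ 2 = 1 - c2 ^+ 2 by rewrite -u2; ring.
by ring.
Qed.

Lemma unit_chord2 c1 s1 c2 s2 : c1 ^+ 2 + s1 ^+ 2 = 1 -> c2 ^+ 2 + s2 ^+ 2 = 1 ->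
  (s1 - s2) ^+ 2 = (1 - (c1 * c2 + s1 * s2)) * (1 + (c1 * c2 - s1 * s2)).
Proof.
move=> u1 u2; have u1' : s1 ^+ 2 + c1 ^+ 2 = 1 by rewrite addrC.
have u2' : s2 ^+ 2 + c2 ^+ 2 = 1 by rewrite addrC.
by rewrite (unit_chord1 u1' u2'); ring.
Qed.

Lemma unit_chord_cross1 c1 s1 c2 s2 : c1 ^+ 2 + s1 ^+ 2 = 1 ->
  c2 ^+ 2 + s2 ^+ 2 = 1 ->
  (c1 - c2) * (c1 * s2 - c2 * s1) = (1 - (c1 * c2 + s1 * s2)) * (s1 + s2).
Proof.
move=> u1 u2.
transitivity (c1 ^+ 2 * s2 + c2 ^+ 2 * s1 - c1 * c2 * (s1 + s2)); first by ring.
have -> : c1 ^+ 2 = 1 - s1 ^+ 2 by rewrite -u1; ring.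
have -> : c2 ^+ 2 = 1 - s2 ^+ 2 by rewrite -u2; ring.
by ring.
Qed.

Lemma unit_chord_cross2 c1 s1 c2 s2 : c1 ^+ 2 + s1 ^+ 2 = 1 ->
  c2 ^+ 2 + s2 ^+ 2 = 1 ->
  (s1 - s2) * (c1 * s2 - c2 * s1) = - (1 - (c1 * c2 + s1 * s2)) * (c1 + c2).
Proof.
move=> u1 u2; have u1' : s1 ^+ 2 + c1 ^+ 2 = 1 by rewrite addrC.
have u2' : s2 ^+ 2 + c2 ^+ 2 = 1 by rewrite addrC.
by have := unit_chord_cross1 u1' u2'; lra.
Qed.

(** Conjugacy of [u1] with [u2] and [u3] makes [(al * c1, be * s1)] orthogonal to [u2 - u3]. On the
    unit circle that chord is orthogonal to [u2 + u3], so the two vectors are parallel. *)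
Lemma conjugate_chord al be c1 s1 c2 s2 c3 s3 :
  c2 ^+ 2 + s2 ^+ 2 = 1 -> c3 ^+ 2 + s3 ^+ 2 = 1 -> c2 * c3 + s2 * s3 != 1 ->
  al * c1 * c2 + be * s1 * s2 = al * c1 * c3 + be * s1 * s3 ->
  al * c1 * (s2 + s3) = be * s1 * (c2 + c3).
Proof.
move=> u2 u3 w1 E; have w0 : 1 - (c2 * c3 + s2 * s3) != 0 by rewrite subr_eq0 eq_sym.
apply: (mulfI w0).
transitivity (al * c1 * ((c2 - c3) * (c2 * s3 - c3 * s2))).
  by rewrite (unit_chord_cross1 u2 u3); ring.
transitivity (- be * s1 * ((s2 - s3) * (c2 * s3 - c3 * s2))).
  by have := congr1 ( *%R (c2 * s3 - c3 * s2)) E; lra.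
by rewrite (unit_chord_cross2 u2 u3); ring.
Qed.

(** The difference of the two parallelism relations is [D], affine in the third point. Multiplying
    it by the cross product of the first two brings out the nonzero factor [1 - u1 . u2], which
    cancels. *)
Lemma conjugate_chord2 al be c1 s1 c2 s2 c3 s3 : al + be = 2 ->
  c1 ^+ 2 + s1 ^+ 2 = 1 -> c2 ^+ 2 + s2 ^+ 2 = 1 -> c1 * c2 + s1 * s2 != 1 ->
  al * c1 * (s2 + s3) = be * s1 * (c2 + c3) ->
  al * c2 * (s1 + s3) = be * s2 * (c1 + c3) ->
  2 * (1 + (c1 * c2 + s1 * s2)) + al * (s1 + s2) * s3 + be * (c1 + c2) * c3 = 0.
Proof.
move=> ab u1 u2 w1 E1 E2.
have w0 : 1 - (c1 * c2 + s1 * s2) != 0 by rewrite subr_eq0 eq_sym.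
have D : 2 * (c1 * s2 - c2 * s1) + al * (c1 - c2) * s3 - be * (s1 - s2) * c3 = 0.
  by rewrite -ab; lra.
have x2 : (c1 * s2 - c2 * s1) ^+ 2
    = (1 - (c1 * c2 + s1 * s2)) * (1 + (c1 * c2 + s1 * s2)).
  transitivity ((c1 ^+ 2 + s1 ^+ 2) * (c2 ^+ 2 + s2 ^+ 2) - (c1 * c2 + s1 * s2) ^+ 2).
    by ring.
  by rewrite u1 u2; ring.
apply: (mulfI w0); rewrite mulr0.
transitivity ((2 * (c1 * s2 - c2 * s1) + al * (c1 - c2) * s3 - be * (s1 - s2) * c3)
              * (c1 * s2 - c2 * s1)); last by rewrite D mul0r.
transitivity (2 * (c1 * s2 - c2 * s1) ^+ 2
   + al * ((c1 - c2) * (c1 * s2 - c2 * s1)) * s3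
   - be * ((s1 - s2) * (c1 * s2 - c2 * s1)) * c3); last by ring.
by rewrite x2 (unit_chord_cross1 u1 u2) (unit_chord_cross2 u1 u2); ring.
Qed.

(** The triangle is self-polar for [al x^2 + be y^2 = ga]; for unit vectors, a scalar product
    different from 1 means distinct points. *)
Lemma self_polar_sum al be ga c1 s1 c2 s2 c3 s3 : al + be = 2 ->
  c1 ^+ 2 + s1 ^+ 2 = 1 -> c2 ^+ 2 + s2 ^+ 2 = 1 -> c3 ^+ 2 + s3 ^+ 2 = 1 ->
  c1 * c2 + s1 * s2 != 1 -> c1 * c3 + s1 * s3 != 1 -> c2 * c3 + s2 * s3 != 1 ->
  al * c1 * c2 + be * s1 * s2 = ga -> al * c1 * c3 + be * s1 * s3 = ga ->
  al * c2 * c3 + be * s2 * s3 = ga ->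
  (c1 * c2 + s1 * s2) + (c1 * c3 + s1 * s3) + (c2 * c3 + s2 * s3) = ga - 1.
Proof.
move=> ab u1 u2 u3 w12 w13 w23 g12 g13 g23.
have E1 : al * c1 * (s2 + s3) = be * s1 * (c2 + c3).
  by apply: conjugate_chord => //; rewrite g12 g13.
have E2 : al * c2 * (s1 + s3) = be * s2 * (c1 + c3).
  by apply: conjugate_chord => //; lra.
have E3 : al * c3 * (s1 + s2) = be * s3 * (c1 + c2).
  by apply: conjugate_chord => //; lra.
have F3 := conjugate_chord2 ab u1 u2 w12 E1 E2.
have F2 : 2 * (1 + (c1 * c3 + s1 * s3)) + al * (s1 + s3) * s2 + be * (c1 + c3) * c2 = 0.
  by apply: conjugate_chord2 => //; rewrite (addrC s3) (addrC c3).
have F1 : 2 * (1 + (c2 * c3 + s2 * s3)) + al * (s2 + s3) * s1 + be * (c2 + c3) * c1 = 0.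
  by apply: conjugate_chord2 => //;
    [rewrite (addrC s3) (addrC c3)|rewrite (addrC s2) (addrC c2)].
(* F1 + F2 + F3 and the sum of the conjugacy relations determine the sum S of
   the scalar products: 6 + 2 S + 2 (2 S - 3 ga) = 0. *)
have beE : be = 2 - al by rewrite -ab; ring.
move: F1 F2 F3 g12 g13 g23; rewrite beE; lra.
Qed.

End UnitChords.

(** * Chords of an ellipse tangent to a confocal ellipse *)

Definition ellipse_polar (R : realType) (E : ellipse R) (v w : plane R) : R :=
  semi_major E ^+ 2 * (v.1 * w.1 + v.2 * w.2)
  - ((focal_vector E).1 * v.1 + (focal_vector E).2 * v.2)
    * ((focal_vector E).1 * w.1 + (focal_vector E).2 * w.2).

(** The form is [semi_minor E ^+ 2] times the squared norm, plus the squared cross product with the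
    focal vector. *)
Lemma ellipse_form_gt0 (R : realType) (E : ellipse R) (v : plane R) :
  is_ellipse E -> 0 < v.1 ^+ 2 + v.2 ^+ 2 -> 0 < ellipse_form E v.
Proof.
move=> hE v0; have := semi_minor_gt0 hE => B0.
have := mulr_gt0 (exprn_gt0 2 B0) v0; rewrite semi_minor_sqr// /ellipse_form.
move: (focal_vector E) (semi_major E) => [f g] A /= h.
have := sqr_ge0 (f * v.2 - g * v.1); lra.
Qed.

(** Joachimsthal's condition: along the line the curve has a quadratic equation, and tangency makes
    its discriminant vanish. *)
Lemma tangent_ellipse (R : realType) (E : ellipse R) (P Q T : plane R) :
  is_ellipse E -> 0 < dist P Q -> tangent_at (line P Q) (ellipse_curve E) T ->
  (ellipse_polar E (from_center E P) (from_center E Q)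
   - (semi_major E * semi_minor E) ^+ 2) ^+ 2
  = (ellipse_form E (from_center E P) - (semi_major E * semi_minor E) ^+ 2)
    * (ellipse_form E (from_center E Q) - (semi_major E * semi_minor E) ^+ 2).
Proof.
move=> hE PQ TE; set N := (_ * _) ^+ 2.
set v := from_center E P; set w := from_center E Q.
set a := ellipse_form E v + ellipse_form E w - 2 * ellipse_polar E v w.
set b := ellipse_polar E v w - ellipse_form E v.
have a0 : 0 < a.
  have -> : a = ellipse_form E (Q.1 - P.1, Q.2 - P.2).
    by rewrite /a /ellipse_form /ellipse_polar /v /w /from_center /=; ring.
  apply: ellipse_form_gt0 => //=; move: PQ; rewrite sqrtr_gt0.
  by rewrite -!(sqrrN (Q.1 - _)) -!(sqrrN (Q.2 - _)) !opprB.
have curveE s : ellipse_curve E (lerp P Q s) <->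
    a * s ^+ 2 + 2 * b * s + (ellipse_form E v - N) = 0.
  rewrite (ellipse_curveE hE) -/N.
  have -> : ellipse_form E (from_center E (lerp P Q s))
    = a * s ^+ 2 + 2 * b * s + ellipse_form E v.
    by rewrite /a /b /ellipse_form /ellipse_polar /v /w /from_center /lerp /=; ring.
  by move: (ellipse_form E v) => k; split=> H; lra.
have [[t _ tT] TC] : (line P Q `&` ellipse_curve E) T by rewrite TE.
have tE : a * t ^+ 2 + 2 * b * t + (ellipse_form E v - N) = 0.
  by apply/curveE; rewrite tT.
have tu s : a * s ^+ 2 + 2 * b * s + (ellipse_form E v - N) = 0 -> s = t.
  move=> /curveE sE; apply: (lerp_inj PQ); rewrite tT.
  have : (line P Q `&` ellipse_curve E) (lerp P Q s) by split=> //; exists s.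
  by rewrite TE.
have abt := unique_root (lt0r_neq0 a0) tE tu.
have bE : b = - (a * t) by lra.
have gE : ellipse_form E v - N = a * t ^+ 2 by move: tE; rewrite bE; lra.
have polE : ellipse_polar E v w - N = b + (ellipse_form E v - N) by rewrite /b; ring.
have formE : ellipse_form E w - N = a + 2 * b + (ellipse_form E v - N).
  by rewrite /a /b; ring.
by rewrite polE formE gE bE; ring.
Qed.

Lemma confocal_chord (R : realType) (A B l c1 s1 c2 s2 : R) :
  0 < A -> 0 < B -> 0 < A ^+ 2 - l -> 0 < B ^+ 2 - l ->
  c1 ^+ 2 + s1 ^+ 2 = 1 -> c2 ^+ 2 + s2 ^+ 2 = 1 ->
  0 < A ^+ 2 * (c1 - c2) ^+ 2 + B ^+ 2 * (s1 - s2) ^+ 2 ->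
  ((B ^+ 2 - l) * A ^+ 2 * (c1 * c2) + (A ^+ 2 - l) * B ^+ 2 * (s1 * s2)
    - (A ^+ 2 - l) * (B ^+ 2 - l)) ^+ 2
  = ((B ^+ 2 - l) * A ^+ 2 * c1 ^+ 2 + (A ^+ 2 - l) * B ^+ 2 * s1 ^+ 2
     - (A ^+ 2 - l) * (B ^+ 2 - l))
    * ((B ^+ 2 - l) * A ^+ 2 * c2 ^+ 2 + (A ^+ 2 - l) * B ^+ 2 * s2 ^+ 2
     - (A ^+ 2 - l) * (B ^+ 2 - l)) ->
  [/\ c1 * c2 + s1 * s2 < 1, 0 < l,
    l * (A ^+ 2 * (c1 - c2) ^+ 2 + B ^+ 2 * (s1 - s2) ^+ 2)
    = (A * B * (1 - (c1 * c2 + s1 * s2))) ^+ 2 &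
    (1 - l / B ^+ 2 + l / A ^+ 2) * c1 * c2
    + (1 + l / B ^+ 2 - l / A ^+ 2) * s1 * s2
    = 1 - l / A ^+ 2 - l / B ^+ 2].
Proof.
move=> A0 B0 m0 n0 u1 u2 d0 T.
set w := c1 * c2 + s1 * s2.
have chord1 := unit_chord1 u1 u2; have chord2 := unit_chord2 u1 u2.
rewrite -/w in chord1 chord2.
have x2 : (c1 * s2 - c2 * s1) ^+ 2 = (1 - w) * (1 + w).
  transitivity ((c1 ^+ 2 + s1 ^+ 2) * (c2 ^+ 2 + s2 ^+ 2) - w ^+ 2).
    by rewrite /w; ring.
  by rewrite u1 u2; ring.
have M0 : 0 < 1 - w.
  rewrite ltNge; apply/negP => M0.
  have := sqr_ge0 (c1 - c2); have := sqr_ge0 (s1 - s2) => h1 h2.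
  have sE : (c1 - c2) ^+ 2 + (s1 - s2) ^+ 2 = 2 * (1 - w).
    by rewrite chord1 chord2; ring.
  have e1 : (c1 - c2) ^+ 2 = 0 by lra.
  have e2 : (s1 - s2) ^+ 2 = 0 by lra.
  by move: d0; rewrite e1 e2 !mulr0 addr0 ltxx.
have mn0 : (A ^+ 2 - l) * (B ^+ 2 - l) != 0 by rewrite mulf_neq0// lt0r_neq0.
(* The two sides of [T] differ by this relation multiplied by the squared inner semi-axes. *)
have T' : (B ^+ 2 - l) * A ^+ 2 * (c1 - c2) ^+ 2 + (A ^+ 2 - l) * B ^+ 2 * (s1 - s2) ^+ 2
    = A ^+ 2 * B ^+ 2 * (c1 * s2 - c2 * s1) ^+ 2.
  apply: (mulfI mn0); apply/eqP; rewrite -subr_eq0 -[X in _ == X](subrr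
   (((B ^+ 2 - l) * A ^+ 2 * (c1 * c2) + (A ^+ 2 - l) * B ^+ 2 * (s1 * s2)
    - (A ^+ 2 - l) * (B ^+ 2 - l)) ^+ 2)) {2}T; apply/eqP; ring.
have D : l * (A ^+ 2 * (c1 - c2) ^+ 2 + B ^+ 2 * (s1 - s2) ^+ 2)
    = (A * B * (1 - w)) ^+ 2.
  transitivity (A ^+ 2 * B ^+ 2 * ((c1 - c2) ^+ 2 + (s1 - s2) ^+ 2 - (c1 * s2 - c2 * s1) ^+ 2)).
    by rewrite mulrBr -T'; ring.
  by rewrite chord1 chord2 x2; ring.
split=> //; first by rewrite -subr_gt0.
  rewrite -(pmulr_lgt0 _ d0) D exprn_gt0// mulr_gt0// mulr_gt0//.
have M1 := lt0r_neq0 M0.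
(* One factor [1 - w] is cancelled from [D]; division by [A^2 B^2] then yields the conjugacy
   relation. *)
have L : l * (A ^+ 2 * (1 - (c1 * c2 - s1 * s2)) + B ^+ 2 * (1 + (c1 * c2 - s1 * s2)))
    = A ^+ 2 * B ^+ 2 * (1 - w).
  apply: (mulfI M1); transitivity ((A * B * (1 - w)) ^+ 2); last by ring.
  by rewrite -D chord1 chord2; ring.
have A1 := lt0r_neq0 A0; have B1 := lt0r_neq0 B0.
apply/eqP; rewrite -subr_eq0; apply/eqP.
transitivity ((l * (A ^+ 2 * (1 - (c1 * c2 - s1 * s2)) + B ^+ 2 * (1 + (c1 * c2 - s1 * s2)))
    - A ^+ 2 * B ^+ 2 * (1 - w)) / (A ^+ 2 * B ^+ 2)).
  by rewrite /w; field; rewrite A1 B1.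
by rewrite L subrr mul0r.
Qed.

(** A unit vector along the major axis; for a circle an arbitrary direction is taken, with
    [phi = 0]. *)
Lemma focal_frame (R : realType) (E : ellipse R) : exists e1 e2 phi : R,
  e1 ^+ 2 + e2 ^+ 2 = 1 /\ focal_vector E = (phi * e1, phi * e2).
Proof.
case: (focal_vector E) => f g; set d := f ^+ 2 + g ^+ 2.
have d_ge0 : 0 <= d by rewrite addr_ge0 ?sqr_ge0.
have [d0|d0] := eqVneq d 0.
  exists 1, 0, 0; rewrite !mul0r expr1n expr0n/= addr0; split=> //.
  by move/eqP: d0; rewrite paddr_eq0 ?sqr_ge0// !sqrf_eq0 => /andP[/eqP -> /eqP ->].
have s0 : Num.sqrt d != 0 by rewrite gt_eqF// sqrtr_gt0 lt_neqAle eq_sym d0.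
exists (f / Num.sqrt d), (g / Num.sqrt d), (Num.sqrt d); split.
  by rewrite !expr_div_n -mulrDl sqr_sqrtr// divff.
by congr pair; rewrite mulrCA divff// mulr1.
Qed.

Lemma eq_set2 (T : Type) (a b c d : T) :
  [set a; b] = [set c; d] -> (a = c /\ b = d) \/ (a = d /\ b = c).
Proof.
move=> S.
have ha : [set c; d] a by rewrite -S; left.
have hb : [set c; d] b by rewrite -S; right.
have hc : [set a; b] c by rewrite S; left.
have hd : [set a; b] d by rewrite S; right.
move: hc hd; case: ha => ->; case: hb => -> hc hd.
- by left; split=> //; case: hd.
- by left.
- by right.
- by right; split=> //; case: hc.
Qed.

(** Foci are compared as an unordered pair, which leaves the sign of the focal vector
    undetermined. *)
Lemma confocal_axes (R : realType) (E E' : ellipse R) : confocal E E' ->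
  ellipse_center E' = ellipse_center E /\
  (focal_vector E' = focal_vector E \/
   focal_vector E' = (- (focal_vector E).1, - (focal_vector E).2)).
Proof.
move=> FE; case: (eq_set2 FE) => [[e1 e2]|[e1 e2]].
  by rewrite /ellipse_center /focal_vector e1 e2; split=> //; left.
rewrite /ellipse_center /focal_vector e1 e2; split.
  by rewrite /midpoint /lerp; congr pair; field.
by right; congr pair => /=; field.
Qed.

(** * Invariance over the Poncelet family *)

Section PonceletFamily.
Variables (R : realType) (E E' : ellipse R) (e1 e2 phi : R).
Hypotheses (hE : is_ellipse E) (hE' : is_ellipse E') (hconf : confocal E E').
Hypotheses (e1e2 : e1 ^+ 2 + e2 ^+ 2 = 1)
  (fE : focal_vector E = (phi * e1, phi * e2)).

Let A := semi_major E.
Let B := semi_minor E.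
(** The confocal parameter: [E'] has squared semi-axes [A ^+ 2 - l] and [B ^+ 2 - l]. *)
Let l := semi_major E ^+ 2 - semi_major E' ^+ 2.

(* Coordinates along the principal axes, scaled so that E becomes the unit circle. *)
Definition unit_point (Q : plane R) : plane R :=
  ((e1 * (from_center E Q).1 + e2 * (from_center E Q).2) / A,
   (e1 * (from_center E Q).2 - e2 * (from_center E Q).1) / B).

Let A0 : 0 < A. Proof. exact: semi_major_gt0. Qed.
Let B0 : 0 < B. Proof. exact: semi_minor_gt0. Qed.
Let A1 : A != 0. Proof. exact: lt0r_neq0. Qed.
Let B1 : B != 0. Proof. exact: lt0r_neq0. Qed.

Let BE : B ^+ 2 = A ^+ 2 - phi ^+ 2.
Proof.
rewrite /B semi_minor_sqr// fE /= -/A; congr (_ - _).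
by rewrite !exprMn -mulrDr e1e2 mulr1.
Qed.

Lemma unit_pointP Q : ellipse_curve E Q ->
  (unit_point Q).1 ^+ 2 + (unit_point Q).2 ^+ 2 = 1.
Proof.
move=> /(ellipse_curveE hE); rewrite -/A -/B /unit_point /ellipse_form fE -/A.
move: (from_center E Q) => [x y] /= formE.
have AB1 : (A * B) ^+ 2 != 0 by rewrite sqrf_eq0 mulf_neq0.
apply: (mulfI AB1); rewrite mulr1 -{2}formE.
transitivity (B ^+ 2 * (e1 * x + e2 * y) ^+ 2 + A ^+ 2 * (e1 * y - e2 * x) ^+ 2).
  by field; rewrite A1 B1.
rewrite BE; transitivity ((e1 ^+ 2 + e2 ^+ 2) * A ^+ 2 * (x ^+ 2 + y ^+ 2)
  - phi ^+ 2 * (e1 * x + e2 * y) ^+ 2); first by ring.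
by rewrite e1e2; ring.
Qed.

Lemma dist_unit_point P Q : dist P Q ^+ 2
  = A ^+ 2 * ((unit_point P).1 - (unit_point Q).1) ^+ 2
    + B ^+ 2 * ((unit_point P).2 - (unit_point Q).2) ^+ 2.
Proof.
rewrite dist_sqr /unit_point /from_center /=.
move: (ellipse_center E) => c.
transitivity ((e1 ^+ 2 + e2 ^+ 2) * ((P.1 - Q.1) ^+ 2 + (P.2 - Q.2) ^+ 2)).
  by rewrite e1e2 mul1r.
by field; rewrite A1 B1.
Qed.

Lemma cross_unit_point P Q S : cross P Q S
  = A * B * cross (unit_point P) (unit_point Q) (unit_point S).
Proof.
rewrite /cross /unit_point /from_center /=.
move: (ellipse_center E) => c.
transitivity ((e1 ^+ 2 + e2 ^+ 2) *
  ((Q.1 - P.1) * (S.2 - P.2) - (Q.2 - P.2) * (S.1 - P.1))).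
  by rewrite e1e2 mul1r.
by field; rewrite A1 B1.
Qed.

(** Confocal ellipses share their principal axes, so the form of [E'] is diagonal in the coordinates
    adapted to [E]. *)
Lemma polar_unit_point P Q :
  ellipse_polar E' (from_center E' P) (from_center E' Q)
  = (B ^+ 2 - l) * A ^+ 2 * ((unit_point P).1 * (unit_point Q).1)
    + (A ^+ 2 - l) * B ^+ 2 * ((unit_point P).2 * (unit_point Q).2).
Proof.
have [cE fE'] := confocal_axes hconf.
have mE : A ^+ 2 - l = semi_major E' ^+ 2 by rewrite /l -/A; ring.
have nE : B ^+ 2 - l = semi_major E' ^+ 2 - phi ^+ 2 by rewrite BE /l -/A; ring.
rewrite mE nE /unit_point.
have fcE Q' : from_center E' Q' = from_center E Q' by rewrite /from_center cE.
rewrite !fcE.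
move: (from_center E P) (from_center E Q) => [x y] [z t] /=.
transitivity (semi_major E' ^+ 2 * (x * z + y * t)
   - phi ^+ 2 * (e1 * x + e2 * y) * (e1 * z + e2 * t)).
  by rewrite /ellipse_polar; case: fE' => ->; rewrite fE /=; ring.
rewrite -[x * z + y * t]mul1r -e1e2.
by field; rewrite A1 B1.
Qed.

Lemma confocal_axes_prod :
  (semi_major E' * semi_minor E') ^+ 2 = (A ^+ 2 - l) * (B ^+ 2 - l).
Proof.
have [_ fE'] := confocal_axes hconf.
rewrite exprMn semi_minor_sqr//.
have -> : (focal_vector E').1 ^+ 2 + (focal_vector E').2 ^+ 2 = phi ^+ 2.
  transitivity (phi ^+ 2 * (e1 ^+ 2 + e2 ^+ 2)); last by rewrite e1e2 mulr1.
  by case: fE' => ->; rewrite fE /=; ring.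
by rewrite BE /l -/A; ring.
Qed.

Definition uprod (P Q : plane R) : R :=
  (unit_point P).1 * (unit_point Q).1 + (unit_point P).2 * (unit_point Q).2.

Lemma poncelet_chord P Q T : ellipse_curve E P -> ellipse_curve E Q ->
  0 < dist P Q -> tangent_at (line P Q) (ellipse_curve E') T ->
  [/\ uprod P Q < 1, 0 < l,
    l * dist P Q ^+ 2 = (A * B * (1 - uprod P Q)) ^+ 2 &
    (1 - l / B ^+ 2 + l / A ^+ 2) * (unit_point P).1 * (unit_point Q).1
    + (1 + l / B ^+ 2 - l / A ^+ 2) * (unit_point P).2 * (unit_point Q).2
    = 1 - l / A ^+ 2 - l / B ^+ 2].
Proof.
move=> PE QE PQ /(tangent_ellipse hE' PQ).
have formE v : ellipse_form E' v = ellipse_polar E' v v.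
  by rewrite /ellipse_form /ellipse_polar; ring.
rewrite !formE !polar_unit_point confocal_axes_prod -!expr2.
rewrite dist_unit_point; apply: confocal_chord => //.
- by rewrite /l -/A opprB addrC subrK exprn_gt0// semi_major_gt0.
- have : 0 < (semi_major E' * semi_minor E') ^+ 2.
    by rewrite exprn_gt0// mulr_gt0 ?semi_major_gt0 ?semi_minor_gt0.
  rewrite confocal_axes_prod pmulr_rgt0//.
  by rewrite /l -/A opprB addrC subrK exprn_gt0// semi_major_gt0.
- exact: unit_pointP.
- exact: unit_pointP.
- by rewrite -dist_unit_point exprn_gt0.
Qed.

Lemma poncelet_side_invariant (P : 'I_3 -> plane R) : poncelet_triangle E E' P ->
  opp_side P ord0 * opp_side P (ordS ord0) * opp_side P (ord_pred ord0)
    * perimeter P / vcross P ord0 ^+ 2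
  = A ^+ 2 * B ^+ 2 * (3 + l / A ^+ 2 + l / B ^+ 2) / (2 * l ^+ 2).
Proof.
move=> [hP PE PT].
have chord i : [/\ uprod (P (ordS i)) (P (ord_pred i)) < 1, 0 < l,
    l * opp_side P i ^+ 2 = (A * B * (1 - uprod (P (ordS i)) (P (ord_pred i)))) ^+ 2 & _]
  := let: ex_intro T hT := PT i in
     poncelet_chord (PE _) (PE _) (opp_side_gt0 hP i) hT.
have [w12 l0 d12 g12] := chord ord0.
have [w20 _ d20 g20] := chord (ordS ord0).
have [w01 _ d01 g01] := chord (ord_pred ord0).
rewrite ?(ordSS3, ordSK, ord_predK, ord_pred_pred3) in w12 d12 g12 w20 d20 g20 w01 d01 g01.
(* The circumradius formula in the unit circle, where squared sides are [2 (1 - u . v)]. *)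
have X2 : 4 * cross (unit_point (P ord0)) (unit_point (P (ordS ord0)))
       (unit_point (P (ord_pred ord0))) ^+ 2
    = 8 * ((1 - uprod (P (ordS ord0)) (P (ord_pred ord0)))
      * (1 - uprod (P (ord_pred ord0)) (P ord0))
      * (1 - uprod (P ord0) (P (ordS ord0)))).
  have uE i : dist (unit_point (P i)) (0, 0) ^+ 2 = 1 ^+ 2.
    by rewrite dist_sqr /= !subr0 expr1n unit_pointP.
  have := cross_circumradius (uE ord0) (uE (ordS ord0)) (uE (ord_pred ord0)).
  rewrite expr1n mulr1 => ->.
  have dE i j : dist (unit_point (P i)) (unit_point (P j)) ^+ 2 = 2 * (1 - uprod (P i) (P j)).
    rewrite dist_sqr (unit_chord1 (unit_pointP (PE i)) (unit_pointP (PE j))).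
    rewrite (unit_chord2 (unit_pointP (PE i)) (unit_pointP (PE j))) -/(uprod _ _).
    by ring.
  by rewrite !dE /uprod; ring.
set k := A * B / Num.sqrt l.
have sl0 : 0 < Num.sqrt l by rewrite sqrtr_gt0.
have k2 : k ^+ 2 = A ^+ 2 * B ^+ 2 / l.
  by rewrite /k expr_div_n exprMn (sqr_sqrtr (ltW l0)).
have k0 : 0 < k by rewrite divr_gt0// mulr_gt0.
have l1 := lt0r_neq0 l0.
(* Taking the positive square root of the chord relation: each side is [k] times [1 - uprod]. *)
have sideE d w : 0 < d -> w < 1 -> l * d ^+ 2 = (A * B * (1 - w)) ^+ 2 -> d = k * (1 - w).
  move=> d0 w1 dE; apply/eqP; rewrite -(@eqrXn2 _ 2) ?(ltW d0)//; last first.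
    by rewrite mulr_ge0 ?(ltW k0)// subr_ge0 ltW.
  by apply/eqP; apply: (mulfI l1); rewrite dE (exprMn _ k) k2; field.
have ab : (1 - l / B ^+ 2 + l / A ^+ 2) + (1 + l / B ^+ 2 - l / A ^+ 2) = 2 by ring.
have sumE := self_polar_sum ab (unit_pointP (PE ord0)) (unit_pointP (PE (ordS ord0)))
   (unit_pointP (PE (ord_pred ord0))).
have {}sumE : uprod (P ord0) (P (ordS ord0)) + uprod (P (ord_pred ord0)) (P ord0)
    + uprod (P (ordS ord0)) (P (ord_pred ord0)) = 1 - l / A ^+ 2 - l / B ^+ 2 - 1.
  rewrite -(sumE _ (negbT (lt_eqF w01)) _ (negbT (lt_eqF w12)) g01 _ g12).
  - by rewrite /uprod; ring.
  - by move: w20; rewrite /uprod => w20; rewrite lt_eqF//; lra.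
  - by rewrite -g20; ring.
have [[a0 b0] c0] := (opp_side_gt0 hP ord0, opp_side_gt0 hP (ordS ord0),
   opp_side_gt0 hP (ord_pred ord0)).
rewrite (perimeterE P ord0) (sideE _ _ a0 w12 d12) (sideE _ _ b0 w20 d20).
rewrite (sideE _ _ c0 w01 d01) /vcross cross_unit_point.
have [m12 m20 m01] : [/\ 0 < 1 - uprod (P (ordS ord0)) (P (ord_pred ord0)),
    0 < 1 - uprod (P (ord_pred ord0)) (P ord0) &
    0 < 1 - uprod (P ord0) (P (ordS ord0))] by split; rewrite subr_gt0.
have {}sumE : (1 - uprod (P (ordS ord0)) (P (ord_pred ord0)))
    + (1 - uprod (P (ord_pred ord0)) (P ord0)) + (1 - uprod (P ord0) (P (ordS ord0)))
    = 3 + l / A ^+ 2 + l / B ^+ 2 by lra.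
move: X2 sumE m12 m20 m01.
move: (1 - uprod _ _) (1 - uprod _ _) (1 - uprod _ _) (cross _ _ _)
  => x y z X X2 sumE /lt0r_neq0 x0 /lt0r_neq0 y0 /lt0r_neq0 z0.
have {}X2 : X ^+ 2 = 2 * (x * y * z) by lra.
(* The sides are [k x], [k y], [k z], and [X ^+ 2] is [2 x y z]: the product cancels, leaving
   [x + y + z], which [sumE] expresses through the ellipses. *)
transitivity ((k ^+ 2) ^+ 2 * (x * y * z) * (z + y + x) / (A ^+ 2 * B ^+ 2 * X ^+ 2)).
  by rewrite (_ : (A * B * X) ^+ 2 = A ^+ 2 * B ^+ 2 * X ^+ 2); [congr (_ * _)|]; ring.
by rewrite X2 sumE k2; field; rewrite x0 y0 z0 A1 B1 l1.
Qed.

End PonceletFamily.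

Theorem theorem3 (R : realType) (E E' : ellipse R)
  (hE : is_ellipse E) (hE' : is_ellipse E') (hconf : confocal E E')
  (hint : ellipse_curve E' `<=` ellipse_interior E)
  (hfam : admits_poncelet3 E E') :
  (exists k : R, forall P : 'I_3 -> plane R, poncelet_triangle E E' P ->
    \sum_(i < 3) circumellipse_area P i / excircle_area P i = k) /\
  (forall P : 'I_3 -> plane R, poncelet_triangle E E' P ->
    \sum_(i < 3) circumellipse_area P i / excircle_area P i
      = 2 / (inradius P / circumradius P)).
Proof.
split; last first.
  by move=> P [hP _ _]; rewrite sum_area_ratio// inradius_circumradius.
have [e1 [e2 [phi [e1e2 fE]]]] := focal_frame E.
(* The constant is left open before [P] is introduced, so it can depend only on the two ellipses;
   the last line supplies it. *)
eexists => P hP; have [tP _ _] := hP.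
rewrite sum_area_ratio//.
exact: (poncelet_side_invariant hE hE' hconf e1e2 fE hP).
Qed.
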